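(* Let $p\in(0,1)$ and let $X$, $\gamma$, $(\mathcal Z,\pi)$ satisfy the standing assumptions described in the context. Then: (i) if $\mathrm{ess\text{-}sup}\,\gamma\le \frac1{1-p}$, $\mathrm{ES}_p$ is robust at $X$ relative to $(\mathcal G_{\rm cm},\mathcal Z,\pi)$; (ii) if $0\le x_0<\mathbb E[\gamma X]$ and either $\gamma$ is constant or ($\gamma$ is continuous and $\gamma(X)$ is continuously distributed), then $\mathrm{ES}_p$ is robust at $X$ relative to $(\mathcal G_{\rm ns},L^q,\pi^q)$ for every $q\in[1,\infty]$, where $\pi^q(Y,Z)=\|Y-Z\|_q$; (iii) if $0\le x_0<m$ and either $\gamma$ is constant or ($\gamma$ is continuous and $\gamma(X)$ is continuously distributed), then $\mathrm{ES}_p$ is robust at $X$ relative to $(\mathcal G_{\rm bd},\mathcal Z,\pi)$.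
   Context: $(\Omega,\mathcal F,\mathbb P)$ is an atomless probability space; $L^0$, $L^q$, $L^\infty$ are the usual spaces of a.s. finite, $q$-integrable, essentially bounded random variables. For $p\in(0,1)$, $\mathrm{VaR}_p(Y)=\inf\{x:\mathbb P(Y\le x)\ge p\}$ and $\mathrm{ES}_p(Y)=\frac1{1-p}\int_p^1\mathrm{VaR}_u(Y)\,\mathrm du$ (possibly $+\infty$). Standing assumptions: $X\ge0$ is a random variable whose distribution has a positive density on its support; $\gamma:\mathbb R\to\mathbb R$ is continuous and strictly positive, and (identifying $\gamma$ with $\gamma(X)$) $\mathbb E[\gamma]=1$, $\mathbb E[\gamma X]<\infty$. $(\mathcal Z,\pi)$ is one of: $(L^\infty,\|\cdot-\cdot\|_\infty)$; $(L^q,\|\cdot-\cdot\|_q)$ for $q\in[1,\infty)$; $(L^0,\pi^W)$ with $\pi^W(Y,Z)$ the Prokhorov distance between the laws of $Y,Z$; and $X\in\mathcal Z$. $\mathcal G_1$ is the set of measurable functions $\mathbb R\to\mathbb R$; $x_0\in\mathbb R$, $m>0$; $\mathcal G_{\rm cm}=\{g\in\mathcal G_1:\mathbb E[\gamma g(X)]\ge x_0\}$, $\mathcal G_{\rm ns}=\{g\in\mathcal G_1:\mathbb E[\gamma g(X)]\ge x_0,\ 0\le g(X)\le X\}$, $\mathcal G_{\rm bd}=\{g\in\mathcal G_1:\mathbb E[\gamma g(X)]\ge x_0,\ 0\le g(X)\le m\}$. For an admissible set $\mathcal G$ and objective $\rho$, $\mathcal G_X(\rho)=\{g\in\mathcal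 G:\rho(g(X))=\inf_{h\in\mathcal G}\rho(h(X))\}$. $\rho$ is robust at $X$ relative to $(\mathcal G,\mathcal Z,\pi)$ if there exists $g_X\in\mathcal G_X(\rho)$ such that $\mathcal Z\ni Y\mapsto\rho(g_X(Y))$ is $\pi$-continuous at $Y=X$. *)

(* Defs.v *)
From HB Require Import structures.
From mathcomp Require Import all_boot all_order all_algebra.
From mathcomp Require Import all_classical all_reals all_analysis ess_sup_inf.
Set Implicit Arguments. Unset Strict Implicit. Unset Printing Implicit Defensive.
Import Order.TTheory GRing.Theory Num.Theory.
Import numFieldNormedType.Exports.
Local Open Scope classical_set_scope.
Local Open Scope ring_scope.

Definition atomless (d : measure_display) (T : measurableType d) (R : realType)
  (P : probability T R) : Prop :=
  forall A : set T, measurable A -> (0 < P A)%E ->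
    exists B : set T, [/\ measurable B, B `<=` A, (0 < P B)%E & (P B < P A)%E].

Definition VaR (d : measure_display) (T : measurableType d) (R : realType)
  (P : probability T R) (p : R) (Y : T -> R) : R :=
  inf [set x : R | (p%:E <= P [set w | (Y w <= x)%R])%E].

Definition ES (d : measure_display) (T : measurableType d) (R : realType)
  (P : probability T R) (p : R) (Y : T -> R) : \bar R :=
  (((1 - p)^-1)%:E *
     \int[@lebesgue_measure R]_(u in `[p, 1%R]) (VaR P u Y)%:E)%E.

(* expectation of a real random variable (MathComp convention: the integral
   is f^+ - f^-, with +oo - +oo = -oo) *)
Definition Ex (d : measure_display) (T : measurableType d) (R : realType)
  (P : probability T R) (Y : T -> R) : \bar R :=
  \int[P]_w (Y w)%:E.

Definition G_cm (d : measure_display) (T : measurableType d) (R : realType)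
  (P : probability T R) (X : T -> R) (gamma : R -> R) (x0 : R) : set (R -> R) :=
  [set g | measurable_fun setT g /\
           (x0%:E <= Ex P (fun w => (gamma (X w) * g (X w))%R))%E].

Definition G_ns (d : measure_display) (T : measurableType d) (R : realType)
  (P : probability T R) (X : T -> R) (gamma : R -> R) (x0 : R) : set (R -> R) :=
  [set g | [/\ measurable_fun setT g,
           (x0%:E <= Ex P (fun w => (gamma (X w) * g (X w))%R))%E &
           forall w, 0 <= g (X w) <= X w]].

Definition G_bd (d : measure_display) (T : measurableType d) (R : realType)
  (P : probability T R) (X : T -> R) (gamma : R -> R) (x0 m : R) : set (R -> R) :=
  [set g | [/\ measurable_fun setT g,
           (x0%:E <= Ex P (fun w => (gamma (X w) * g (X w))%R))%E &
           forall w, 0 <= g (X w) <= m]].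

Definition enlarge (R : realType) (A : set R) (e : R) : set R :=
  [set x | exists2 y, A y & `|x - y| < e].

Definition prokhorov (d : measure_display) (T : measurableType d) (R : realType)
  (P : probability T R) (Y Z : T -> R) : \bar R :=
  ereal_inf [set e%:E | e in [set e : R | 0 < e /\
     forall A : set R, measurable A ->
       (P (Y @^-1` A) <= P (Z @^-1` enlarge A e) + e%:E)%E /\
       (P (Z @^-1` A) <= P (Y @^-1` enlarge A e) + e%:E)%E]].

Inductive zspace (R : realType) : Type :=
  | ZLinf : zspace R
  | ZLq : R -> zspace R
  | ZL0 : zspace R.

Definition zvalid (R : realType) (s : zspace R) : Prop :=
  match s with ZLq q => 1 <= q | _ => True end.

Definition Zset (d : measure_display) (T : measurableType d) (R : realType)
  (P : probability T R) (s : zspace R) : set (T -> R) :=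
  match s with
  | ZLinf => [set Y | measurable_fun setT Y /\
                 (Lnorm P +oo%E (EFin \o Y) < +oo)%E]
  | ZLq q => [set Y | measurable_fun setT Y /\
                 (Lnorm P q%:E (EFin \o Y) < +oo)%E]
  | ZL0 => [set Y | measurable_fun setT Y]
  end.

Definition Zdist (d : measure_display) (T : measurableType d) (R : realType)
  (P : probability T R) (s : zspace R) (Y Z : T -> R) : \bar R :=
  match s with
  | ZLinf => Lnorm P +oo%E (EFin \o (Y \- Z))
  | ZLq q => Lnorm P q%:E (EFin \o (Y \- Z))
  | ZL0 => prokhorov P Y Z
  end.

Definition robust_at (d : measure_display) (T : measurableType d) (R : realType)
  (rho : (T -> R) -> \bar R) (G : set (R -> R)) (Z : set (T -> R))
  (pi : (T -> R) -> (T -> R) -> \bar R) (X : T -> R) : Prop :=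
  exists g : R -> R,
    [/\ G g,
        rho (g \o X) = ereal_inf [set rho (h \o X) | h in G] &
        forall U : set (\bar R), nbhs (rho (g \o X)) U ->
          exists2 del : R, 0 < del &
            forall Y, Z Y -> (pi Y X < del%:E)%E -> U (rho (g \o Y))].

Definition law_support (d : measure_display) (T : measurableType d) (R : realType)
  (P : probability T R) (X : T -> R) : set R :=
  [set x | forall e : R, 0 < e -> (0 < P (X @^-1` [set y | (`|y - x| < e)%R]))%E].

Definition pos_density (d : measure_display) (T : measurableType d) (R : realType)
  (P : probability T R) (X : T -> R) : Prop :=
  exists f : R -> R,
    [/\ measurable_fun setT f, (forall x, 0 <= f x),
        (forall A : set R, measurable A ->
           (P (X @^-1` A) = \int[@lebesgue_measure R]_(x in A) (f x)%:E)%E) &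
        (forall x, law_support P X x -> 0 < f x)].

Definition standing (d : measure_display) (T : measurableType d) (R : realType)
  (P : probability T R) (X : T -> R) (gamma : R -> R) : Prop :=
  [/\ measurable_fun setT X, (forall w, 0 <= X w), pos_density P X,
      continuous gamma /\ (forall x, 0 < gamma x) &
      Ex P (fun w => gamma (X w)) = 1%E /\
      (Ex P (fun w => (gamma (X w) * X w)%R) < +oo)%E].

(* Main.v *)
Require Import Defs.
From HB Require Import structures.
From mathcomp Require Import all_boot all_order all_algebra.
From mathcomp Require Import all_classical all_reals all_analysis ess_sup_inf.
From mathcomp Require Import measurable_realfun lra.
Set Implicit Arguments. Unset Strict Implicit. Unset Printing Implicit Defensive.
Import Order.TTheory GRing.Theory Num.Theory.
Import numFieldNormedType.Exports.
Local Open Scope classical_set_scope.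
Local Open Scope ring_scope.

(* Rockafellar-Uryasev: ES_p(Y) is the minimum over c of
   c + E(Y - c)^+ / (1 - p), attained at c = VaR_p(Y).  Hence ES_p(Y) >= E[gamma Y]
   when 0 <= gamma <= 1/(1-p), so the constant x0 is optimal in (i).

   In (ii) and (iii) the constraint is 0 <= g(X) <= b(X), with b(x) = x or b = m.
   For a fixed level c, a Neyman-Pearson argument shows that the best exposure is
   b where gamma > k and min(b, c) elsewhere, k being fixed by the budget
   constraint (if gamma is constant, min(b, c1) works for all levels).  The optimal
   value is Lipschitz in c, so a best level exists, and the corresponding g is an
   optimizer.  It jumps only across {gamma = k}, which X avoids almost surely.
   Since ES_p is Lipschitz for the L^1 norm, this gives continuity along L^q; for
   b = m the variable g(Y) takes two values and ES_p(g(Y)) depends only on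
   P(Y in A), A = {gamma > k}, which is continuous for the Prokhorov distance. *)

(** The set of exposures has no evident compactness, so attainment of the infimum is the obstacle.
    Since ES is itself a minimum over levels c, the problem is a joint minimization in (g, c), and
    the g-part is solved outcome by outcome with k as the multiplier of the budget. Only the levels
    are left, and they can be confined to [0, c1], where c1 is the cap with E[gamma min(b, c1)] =
    x0: exposures are nonnegative, hence so is their VaR, and an exposure with VaR above c1 is
    beaten by min(b, c1), which never exceeds c1. The optimal value is Lipschitz in c because it is
    an infimum of 1-Lipschitz functions of c.

    The other obstacle is the jump of the optimizer. Its height is controlled by b(X), which may be
    unbounded in (ii), so smallness comes from three sources: a thin zone around the boundary of A,
    a truncation of b(X), and closeness of Y to X elsewhere. Under Prokhorov closeness Y need not be
    near X pointwise; only the probability of A can then be compared. *)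

Section integral_complements.
Context (d : measure_display) (T : measurableType d) (R : realType)
  (mu : {measure set T -> \bar R}) (D : set T).
Hypothesis mD : measurable D.
Local Open Scope ereal_scope.

(* No integrability is required: [leeB] is monotone even when the difference
   of positive and negative parts is [+oo - +oo]. *)
Lemma ae_le_integral (f g : T -> \bar R) :
  measurable_fun D f -> measurable_fun D g ->
  {ae mu, forall x, D x -> f x <= g x} ->
  \int[mu]_(x in D) f x <= \int[mu]_(x in D) g x.
Proof.
move=> mf mg fg; rewrite [leLHS]integralE [leRHS]integralE; apply: leeB.
  apply: ae_ge0_le_integral => //; [exact: measurable_funepos..|].
  apply: filterS fg => x fgx Dx; rewrite !funeposE ge_max le_max fgx// le_max.
  by rewrite lexx orbT.
apply: ae_ge0_le_integral => //; [exact: measurable_funeneg..|].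
apply: filterS fg => x fgx Dx; rewrite !funenegE ge_max !le_max leeN2 fgx//.
by rewrite lexx orbT.
Qed.

Lemma le_integral_fun (f g : T -> \bar R) :
  measurable_fun D f -> measurable_fun D g -> (forall x, D x -> f x <= g x) ->
  \int[mu]_(x in D) f x <= \int[mu]_(x in D) g x.
Proof. by move=> mf mg fg; apply: ae_le_integral => //; exact: aeW. Qed.

(** When the integral of [f] is infinite, the negative part of [c + f] is still at most [|c|] on a
    set of finite measure, while its positive part must have infinite integral; both sides are then
    [+oo]. This case occurs for quantile functions with a heavy upper tail. *)
Lemma integral_cstD (c : R) (f : T -> R) : mu D < +oo ->
  measurable_fun D f -> (forall x, D x -> 0 <= f x)%R ->
  \int[mu]_(x in D) (c + f x)%:E = c%:E * mu D + \int[mu]_(x in D) (f x)%:E.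
Proof.
move=> muD mf f0.
have fmuD : mu D \is a fin_num by rewrite ge0_fin_numE.
have mfE : measurable_fun D (EFin \o f) by exact/measurable_EFinP.
have [foo|foo] := ltP (\int[mu]_(x in D) (f x)%:E) +oo.
  have intf : mu.-integrable D (EFin \o f).
    apply/integrableP; split => //; rewrite (eq_integral (EFin \o f))//.
    by move=> x /set_mem Dx /=; rewrite ger0_norm// f0.
  have intc : mu.-integrable D (EFin \o cst c).
    apply/integrableP; split; first exact/measurable_EFinP.
    rewrite (eq_integral (cst `|c|%:E))// integral_cst//.
    by rewrite ltey_eq fin_numM.
  have := integralD_EFin mD intc intf.
  rewrite [X in _ = X + _ -> _](integral_cst mu mD c%:E) => <-.
  by apply: eq_integral => x _ /=; rewrite EFinD.
have fE : \int[mu]_(x in D) (f x)%:E = +oo.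
  by apply/eqP; rewrite eq_le leey foo.
have mcf : measurable_fun D (fun x => (c + f x)%:E).
  by apply/measurable_EFinP; apply: measurable_funD => //; exact: measurable_cst.
have fcD (r : R) : r%:E * mu D \is a fin_num by rewrite fin_numM.
rewrite fE addey; last by move: (fcD c); case: (_ * _).
rewrite integralE.
have n1 : \int[mu]_(x in D) (fun x => (c + f x)%:E)^\- x <= `|c|%:E * mu D.
  rewrite -integral_cst//; apply: ge0_le_integral => //.
    exact: measurable_funeneg.
  move=> x Dx; rewrite funenegE -EFinN -EFin_max lee_fin ge_max normr_ge0 andbT.
  by have := f0 _ Dx; have := ler_norm (- c)%R; rewrite normrN; lra.
have p1 : \int[mu]_(x in D) (fun x => (c + f x)%:E)^\+ x = +oo.
  apply/eqP; rewrite eq_le leey/= leNgt; apply/negP => poo.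
  suff : \int[mu]_(x in D) (f x)%:E < +oo by rewrite fE.
  apply: (@le_lt_trans _ _
    (\int[mu]_(x in D) ((fun x => (c + f x)%:E)^\+ x + `|c|%:E))).
    apply: ge0_le_integral => //.
    - by apply: emeasurable_funD => //; exact: measurable_funepos.
    - move=> x Dx; rewrite funeposE -EFin_max -EFinD lee_fin.
      rewrite -lerBlDr le_max; apply/orP; left.
      by have := f0 _ Dx; have := ler_norm (- c)%R; rewrite normrN; lra.
  rewrite ge0_integralD//; last exact: measurable_funepos.
  rewrite integral_cst// lte_add_pinfty//.
  by move: (fcD `|c|%R); rewrite fin_numElt => /andP[].
rewrite p1 addye// -ltNye lteNr/=.
by apply: (le_lt_trans n1); move: (fcD `|c|%R); rewrite fin_numElt => /andP[].
Qed.

End integral_complements.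

(** * Quantiles and the Rockafellar-Uryasev formula *)

Section expected_shortfall.
Context (d : measure_display) (T : measurableType d) (R : realType)
  (P : probability T R).
Implicit Types (Y Z : T -> R) (p u x c : R).

(** The Galois connection between quantile and distribution function. The limits of the cdf at both
    infinities make the set nonempty and bounded below, so that [inf] is not a default value, and
    right continuity of the cdf makes the infimum attained. *)
Lemma VaR_le_cdf Y u x : measurable_fun setT Y -> 0 < u < 1 ->
  (VaR P u Y <= x) = (u%:E <= P [set w | (Y w <= x)%R])%E.
Proof.
move=> mY /andP[u0 u1].
pose Y' : {RV P >-> R} := HB.pack Y (isMeasurableFun.Build _ _ _ _ Y mY).
have FE r : P [set w | (Y w <= r)%R] = cdf Y' r.
  by rewrite /cdf /distribution /pushforward; congr (P _);
    apply/seteqP; split => w /=; rewrite in_itv.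
rewrite /VaR; set S := (X in inf X).
have SE r : S r = (u%:E <= cdf Y' r)%E :> Prop by rewrite /S /= FE.
have nd := @cdf_nondecreasing _ _ _ P Y'.
have S0 : S !=set0.
  apply/set0P/negP => /eqP S0.
  have : (limn (fun n => cdf Y' n%:R) <= u%:E)%E.
    apply: lime_le.
      apply/cvg_ex; exists 1%E.
      by move/cvge_pinftyP: (@cvg_cdfy1 _ _ _ P Y'); apply; exact: cvgr_idn.
    apply: nearW => n; rewrite leNgt; apply/negP => /ltW h.
    suff : S n%:R by rewrite S0.
    by rewrite SE.
  rewrite (@cvg_lim _ _ _ _ _ _ 1%E)//; last first.
    by move/cvge_pinftyP: (@cvg_cdfy1 _ _ _ P Y'); apply; exact: cvgr_idn.
  by rewrite lee_fin leNgt u1.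
have Slb : has_lbound S.
  have [r ru] : exists r, (cdf Y' r < u%:E)%E.
    apply/not_existsP => h.
    have : (u%:E <= lim (cdf Y' r @[r --> -oo%R]))%E.
      apply: lime_ge; first by apply/cvg_ex; exists 0%E; exact: cvg_cdfNy0.
      by apply: nearW => n; rewrite leNgt; apply/negP => /h.
    rewrite (@cvg_lim _ _ _ _ _ _ 0%E)//; last exact: cvg_cdfNy0.
    by rewrite lee_fin leNgt u0.
  exists r => s; rewrite SE => us; rewrite leNgt; apply/negP => /ltW/nd sr.
  by have := le_lt_trans (le_trans us sr) ru; rewrite ltxx.
rewrite FE; apply/idP/idP => h; last by apply: ge_inf => //; rewrite SE.
have cr := @cdf_right_continuous _ _ _ P Y' x.
rewrite -(cvg_lim _ cr)//; apply: lime_ge; first by apply/cvg_ex; exists (cdf Y' x).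
near=> r.
have [s Ss sr] : exists2 s, S s & s < r.
  by apply: inf_lt => //; rewrite (le_lt_trans h)//; near: r; exact: nbhs_right_gt.
by apply: le_trans (nd _ _ (ltW sr)); rewrite -SE.
Unshelve. all: by end_near. Qed.

Definition stop_loss Y c : \bar R := (\int[P]_w (Num.max (Y w - c) 0)%:E)%E.

Lemma measurable_excess Y c : measurable_fun setT Y ->
  measurable_fun setT (fun w => Num.max (Y w - c) 0).
Proof.
move=> mY; apply: measurable_maxr => //.
by apply: measurable_funB => //; exact: measurable_cst.
Qed.

Lemma uniform_prob01_itv x : 0 <= x <= 1 ->
  uniform_prob (@ltr01 R) `]x, 1[%classic = (1 - x)%:E.
Proof.
move=> /andP[x0 x1]; rewrite /uniform_prob integral_uniform_pdf setIidl; last first.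
  move=> u /=; rewrite !in_itv/= => /andP[xu u1].
  by rewrite (ltW u1) (le_trans x0 (ltW xu)).
rewrite (eq_integral (cst 1%E)); last first.
  move=> u; rewrite inE/= in_itv/= => /andP[xu u1].
  by rewrite /uniform_pdf (ltW u1) (le_trans x0 (ltW xu)) subr0 invr1.
rewrite integral_cst//= mul1e lebesgue_measure_itv/= lte_fin.
move: x1; rewrite le_eqVlt => /predU1P[->|x1]; first by rewrite ltxx subrr.
by rewrite x1 EFinB.
Qed.

(** The quantile of a uniform variable has the law of [Y]. Both sides are integrals of tail
    probabilities over [r >= 0], and the Galois connection turns [{Q > r}] into the interval from
    [F (c + r)] to 1, whose length is the tail probability of [Y - c]. *)
Lemma integral_excess_VaR Y c : measurable_fun setT Y ->
  (\int[@lebesgue_measure R]_(u in `]0%R, 1%R[) (Num.max (VaR P u Y - c) 0)%:E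
   = stop_loss Y c)%E.
Proof.
(* Outside the open unit interval [VaR] may be a default value, so [Q] is set to 0 there. *)
move=> mY; pose Q (u : R) : R := if 0 < u < 1 then Num.max (VaR P u Y - c) 0 else 0.
pose F r := fine (P [set w | (Y w <= r)%R]).
have mYle r : measurable [set w | (Y w <= r)%R].
  rewrite -[X in measurable X]setTI.
  have -> : [set w | (Y w <= r)%R] = Y @^-1` `]-oo, r].
    by apply/seteqP; split => w /=; rewrite in_itv.
  by apply: mY => //; exact: measurable_itv.
have FE r : P [set w | (Y w <= r)%R] = (F r)%:E by rewrite fineK// fin_num_measure.
have F01 r : 0 <= F r <= 1.
  by rewrite -!lee_fin -FE measure_ge0 probability_le1.
have QE r : 0 <= r -> Q @^-1` `]r, +oo[ = `]F (c + r), 1[%classic.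
  move=> r0; apply/seteqP; split => u /=; rewrite !in_itv/= andbT /Q.
    case: ifPn => [u01|_]; last by rewrite ltNge r0.
    rewrite lt_max ltNge lerBlDl (VaR_le_cdf _ mY u01) FE lee_fin -ltNge.
    by case/andP: u01 => _ ->; rewrite [r < 0]ltNge r0 orbF => ->.
  move=> /andP[Fu u1]; have u01 : 0 < u < 1.
    by rewrite u1 (le_lt_trans _ Fu)//; case/andP: (F01 (c + r)).
  by rewrite u01 lt_max ltNge lerBlDl (VaR_le_cdf _ mY u01) FE lee_fin -ltNge Fu.
have Q0 u : 0 <= Q u by rewrite /Q; case: ifP => // _; rewrite le_max lexx orbT.
have mQ : measurable_fun setT Q.
  apply: (measurability (@RGenOInfty.G R)) => [|/= _ [_] [r] -> <-].
    exact: RGenOInfty.measurableE.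
  rewrite setTI; have [r0|r0] := leP 0 r.
    by rewrite QE//; exact: measurable_itv.
  rewrite (_ : _ @^-1` _ = setT)//; apply/seteqP; split => // u _ /=.
  by rewrite in_itv/= andbT (lt_le_trans r0).
pose U := uniform_prob (@ltr01 R).
pose Qu : measurableTypeR R -> R := Q.
have mQu : measurable_fun setT Qu := mQ.
pose Q' : {RV U >-> R} := HB.pack Qu (isMeasurableFun.Build _ _ _ _ Qu mQu).
pose E w := Num.max (Y w - c) 0.
have mE : measurable_fun setT E by exact: measurable_excess.
pose E' : {RV P >-> R} := HB.pack E (isMeasurableFun.Build _ _ _ _ E mE).
have E0 w : 0 <= E w by rewrite le_max lexx orbT.
transitivity (\int[U]_u (Q u)%:E)%E.
  rewrite integral_uniform//; last exact/measurable_EFinP.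
  rewrite subr0 invr1 mul1e [RHS]integral_itv_bndoo; last first.
    by apply/measurable_EFinP; exact: measurable_funTS.
  by apply: eq_integral => u; rewrite inE/= in_itv/= /Q => ->.
have := @ge0_expectation_ccdf _ _ R U Q' Q0.
rewrite expectation_def => ->.
have := @ge0_expectation_ccdf _ _ R P E' E0.
rewrite expectation_def /stop_loss => ->.
apply: eq_integral => r; rewrite inE/= in_itv/= andbT => r0.
rewrite /ccdf /distribution /pushforward /= QE// uniform_prob01_itv//.
have -> : E @^-1` `]r, +oo[ = ~` [set w | (Y w <= c + r)%R].
  apply/seteqP; split => w /=; rewrite in_itv/= andbT lt_max [r < 0]ltNge r0 orbF.
    by rewrite ltNge lerBlDl => /negP.
  by rewrite ltNge lerBlDl => /negP.
by rewrite probability_setC// FE EFinB.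
Qed.

Lemma measurable_VaR Y : measurable_fun setT Y ->
  measurable_fun (`]0, 1[%classic : set R) (fun u => VaR P u Y).
Proof.
move=> mY; apply: (measurability (@RGenOInfty.G R)) => [|/= _ [_] [r] -> <-].
  exact: RGenOInfty.measurableE.
apply: is_interval_measurable => s t /=; rewrite !in_itv/= !andbT.
move=> [/andP[s0 s1] rs] [/andP[t0 t1] rt] u /andP[su ut].
have u01 : 0 < u < 1 by rewrite (lt_le_trans s0)//= (le_lt_trans ut).
split; rewrite /= in_itv/= ?andbT //; move: rs.
rewrite !ltNge (VaR_le_cdf _ mY) ?s0// (VaR_le_cdf _ mY u01).
by apply: contraNN; apply: le_trans; rewrite lee_fin.
Qed.

Lemma VaR_nondecreasing Y u v : measurable_fun setT Y -> 0 < u -> v < 1 -> u <= v ->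
  VaR P u Y <= VaR P v Y.
Proof.
move=> mY u0 v1 uv; rewrite (VaR_le_cdf _ mY) ?u0 ?(le_lt_trans uv)//.
rewrite (@le_trans _ _ v%:E) ?lee_fin//.
by rewrite -(VaR_le_cdf _ mY) ?lexx// v1 (lt_le_trans u0).
Qed.

(** Removes the endpoint 1, where the set defining the quantile can be empty and [VaR] meaningless;
    points have measure zero. *)
Lemma ES_itvoo Y p : measurable_fun setT Y -> 0 < p < 1 ->
  ES P p Y = (((1 - p)^-1)%:E *
     \int[@lebesgue_measure R]_(u in `]p, 1%R[) (VaR P u Y)%:E)%E.
Proof.
move=> mY /andP[p0 p1]; rewrite /ES integral_itv_bndoo//.
apply/measurable_EFinP; apply: measurable_funS (measurable_VaR mY) => //.
by move=> u /=; rewrite !in_itv/= => /andP[pu ->]; rewrite (lt_trans p0).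
Qed.

Let itv_sub p : 0 < p -> (`]p, 1[%classic : set R) `<=` `]0, 1[%classic.
Proof.
by move=> p0 u /=; rewrite !in_itv/= => /andP[pu ->]; rewrite (lt_trans p0).
Qed.

Let measurable_excess_VaR Y c : measurable_fun setT Y ->
  measurable_fun (`]0, 1[%classic : set R) (fun u => Num.max (VaR P u Y - c) 0).
Proof.
move=> mY; apply: measurable_maxr => //.
by apply: measurable_funB => //; exact: measurable_VaR.
Qed.

Let integral_itvoo_cstD p c (f : R -> R) : 0 < p < 1 ->
  measurable_fun (`]p, 1[%classic : set R) f -> (forall u, 0 <= f u) ->
  (((1 - p)^-1)%:E * \int[@lebesgue_measure R]_(u in `]p, 1%R[) (c + f u)%:E =
  c%:E + ((1 - p)^-1)%:E * \int[@lebesgue_measure R]_(u in `]p, 1%R[) (f u)%:E)%E.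
Proof.
move=> /andP[p0 p1] mf f0.
have mu1 : lebesgue_measure (`]p, 1[%classic : set R) = (1 - p)%:E.
  by rewrite lebesgue_measure_itv/= lte_fin p1 EFinB.
rewrite integral_cstD//; last by move=> *; rewrite ?[X in (X < _)%E]mu1 ?ltry.
rewrite (_ : (_ * _ + _)%E = (c%:E * (1 - p)%:E +
    \int[@lebesgue_measure R]_(u in `]p, 1%R[) (f u)%:E)%E); last first.
  by congr (_ * _ + _)%E; exact: mu1.
rewrite muleDr//.
by rewrite -EFinM mulrC -mulrA divff ?mulr1// subr_eq0 gt_eqF.
Qed.

(** Two losses are made: VaR_u <= c + (VaR_u - c)^+ on the interval from [p] to 1, and the extension
    of the excess integral down to 0. *)
Lemma ES_le_stop_loss Y p c : measurable_fun setT Y -> 0 < p < 1 ->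
  (ES P p Y <= c%:E + ((1 - p)^-1)%:E * stop_loss Y c)%E.
Proof.
move=> mY p01; have /andP[p0 p1] := p01.
have me : measurable_fun (`]p, 1[%classic : set R) (fun u => Num.max (VaR P u Y - c) 0).
  by apply: measurable_funS (measurable_excess_VaR c mY) => //; exact: itv_sub.
have e0 u : 0 <= Num.max (VaR P u Y - c) 0 by rewrite le_max lexx orbT.
have p'0 : 0 <= (1 - p)^-1 by rewrite invr_ge0 subr_ge0 ltW.
rewrite ES_itvoo// -integral_excess_VaR//.
apply: (@le_trans _ _ (((1 - p)^-1)%:E * \int[@lebesgue_measure R]_(u in `]p, 1%R[)
    (c + Num.max (VaR P u Y - c) 0)%:E)%E).
  apply: lee_wpmul2l; rewrite ?lee_fin//.
  apply: le_integral_fun => //.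
  - apply/measurable_EFinP; apply: measurable_funS (measurable_VaR mY) => //.
    exact: itv_sub.
  - by apply/measurable_EFinP; apply: measurable_funD => //; exact: measurable_cst.
  - by move=> u _; rewrite lee_fin -lerBlDl le_max lexx.
rewrite integral_itvoo_cstD// leeD2l// lee_wpmul2l ?lee_fin//.
apply: ge0_subset_integral => //.
- by apply/measurable_EFinP; exact: measurable_excess_VaR.
- by move=> u _; rewrite lee_fin.
- exact: itv_sub.
Qed.

(** At the level VaR_p both losses of the general bound vanish by monotonicity of the quantile:
    VaR_u is above the level for [u > p], and the excess is zero for [u <= p]. *)
Lemma ES_stop_loss_VaR Y p : measurable_fun setT Y -> 0 < p < 1 ->
  ES P p Y = ((VaR P p Y)%:E + ((1 - p)^-1)%:E * stop_loss Y (VaR P p Y))%E.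
Proof.
move=> mY p01; have /andP[p0 p1] := p01; set v := VaR P p Y.
have me : measurable_fun (`]p, 1[%classic : set R) (fun u => Num.max (VaR P u Y - v) 0).
  by apply: measurable_funS (measurable_excess_VaR v mY) => //; exact: itv_sub.
have e0 u : 0 <= Num.max (VaR P u Y - v) 0 by rewrite le_max lexx orbT.
rewrite ES_itvoo// -integral_excess_VaR//.
rewrite (eq_integral (fun u : measurableTypeR R =>
    (v + Num.max (VaR P u Y - v) 0)%:E)); last first.
  move=> u; rewrite inE/= in_itv/= => /andP[pu u1]; congr EFin.
  have : v <= VaR P u Y by apply: VaR_nondecreasing => //; exact: ltW.
  by rewrite -subr_ge0 => h; rewrite max_l// addrC subrK.
rewrite integral_itvoo_cstD//; congr (_ + _ * _)%E.
have pU : `]0, 1[%classic = `]0, p] `|` `]p, 1[ :> set R.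
  by rewrite -itv_bndbnd_setU// bnd_simp// ltW.
rewrite pU ge0_integral_setU//; last 3 first.
- by rewrite -pU; apply/measurable_EFinP; exact: measurable_excess_VaR.
- by move=> u _; rewrite lee_fin.
- rewrite disj_set2E; apply/eqP/seteqP; split => // u [] /=.
  by rewrite !in_itv/= => /andP[_ up] /andP[pu _]; move: (lt_le_trans pu up); rewrite ltxx.
rewrite [X in (_ = X + _)%E]integral0_eq ?add0e// => u /=.
rewrite in_itv/= => /andP[u0 up]; rewrite max_r// subr_le0.
exact: VaR_nondecreasing.
Qed.

End expected_shortfall.

(** * Stability of ES under changes of the stop-loss, and its lower bound by densities *)

Section ES_estimates.
Context (d : measure_display) (T : measurableType d) (R : realType)
  (P : probability T R) (p : R).
Hypothesis p01 : 0 < p < 1.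
Implicit Types (Y Z : T -> R) (c e : R).

Let p'0 : 0 < (1 - p)^-1.
Proof. by rewrite invr_gt0 subr_gt0; case/andP: p01. Qed.

Lemma stop_loss_ge0 Y c : (0 <= stop_loss P Y c)%E.
Proof. by apply: integral_ge0 => w _; rewrite lee_fin le_max lexx orbT. Qed.

Lemma ES_ge_VaR Y : measurable_fun setT Y -> ((VaR P p Y)%:E <= ES P p Y)%E.
Proof.
move=> mY; rewrite ES_stop_loss_VaR// leeDl// mule_ge0 ?stop_loss_ge0//.
by rewrite lee_fin ltW.
Qed.

(** The level VaR_p(Z) is exact for [Z] and still gives an upper bound for [Y]. *)
Lemma ES_le_add Y Z e : measurable_fun setT Y -> measurable_fun setT Z ->
  (forall c, stop_loss P Y c <= stop_loss P Z c + e%:E)%E ->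
  (ES P p Y <= ES P p Z + ((1 - p)^-1 * e)%:E)%E.
Proof.
move=> mY mZ YZ; rewrite (ES_stop_loss_VaR P mZ p01).
apply: (le_trans (ES_le_stop_loss P (VaR P p Z) mY p01)).
rewrite -addeA leeD2l// EFinM -muleDr ?fin_num_adde_defl//.
by apply: lee_wpmul2l; [rewrite lee_fin ltW|exact: YZ].
Qed.

Lemma nbhs_ES Z (U : set (\bar R)) : measurable_fun setT Z ->
  ES P p Z \is a fin_num -> nbhs (ES P p Z) U ->
  exists2 e, 0 < e & forall Y, measurable_fun setT Y ->
    (forall c, stop_loss P Y c <= stop_loss P Z c + e%:E)%E ->
    (forall c, stop_loss P Z c <= stop_loss P Y c + e%:E)%E ->
    U (ES P p Y).
Proof.
move=> mZ fZ; rewrite -(fineK fZ); set r := fine _ => Ur.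
have /nbhs_ballP[e' /= e'0 eU] : nbhs r (fun x : R => U x%:E) by [].
(* The factor [1 - p] cancels the constant of [ES_le_add], leaving a deviation of at most
   [e' / 2]. *)
exists (e' / 2 * (1 - p)); first by rewrite !mulr_gt0 ?invr_gt0// subr_gt0; case/andP: p01.
move=> Y mY YZ ZY.
have p1 : (1 - p)^-1 * (e' / 2 * (1 - p)) = e' / 2.
  by rewrite mulrCA mulVf ?mulr1// subr_eq0 gt_eqF//; case/andP: p01.
have := ES_le_add mY mZ YZ; have := ES_le_add mZ mY ZY.
rewrite p1 -(fineK fZ) -/r.
case: (ES P p Y) => [y||] //; rewrite -!EFinD !lee_fin => h1 h2.
suff : ball r e' y by move=> ?; exact: eU.
by rewrite /ball/= ltr_norml; lra.
Qed.

(** Weak duality: D Y <= v D + (Y - v)^+ / (1 - p) holds almost surely for a density D bounded by 1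
    / (1 - p), and integrating it with E D = 1 produces the Rockafellar-Uryasev value at v. *)
Lemma expectation_le_ES (D Y : T -> R) : measurable_fun setT D ->
  measurable_fun setT Y -> (forall w, 0 <= D w) ->
  (\forall w \ae P, D w <= (1 - p)^-1) -> (\int[P]_w (D w)%:E = 1)%E ->
  (\int[P]_w (D w * Y w)%:E <= ES P p Y)%E.
Proof.
move=> mD mY D0 Dp D1; rewrite ES_stop_loss_VaR//; set v := VaR P p Y.
have me := measurable_excess v mY.
have [foo|foo] := ltP (stop_loss P Y v) +oo%E; last first.
  have -> : stop_loss P Y v = +oo%E by apply/eqP; rewrite eq_le leey foo.
  by rewrite gt0_muley ?lte_fin// addey// leey.
have ie : P.-integrable setT (EFin \o (fun w => Num.max (Y w - v) 0)).
  apply/integrableP; split; first exact/measurable_EFinP.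
  rewrite (eq_integral (fun w => (Num.max (Y w - v) 0)%:E))// => w _ /=.
  by rewrite ger0_norm// le_max lexx orbT.
have iD : P.-integrable setT (EFin \o D).
  apply/integrableP; split; first exact/measurable_EFinP.
  rewrite (eq_integral (fun w => (D w)%:E)) ?D1 ?ltry// => w _ /=.
  by rewrite ger0_norm.
have -> : (v%:E + ((1 - p)^-1)%:E * stop_loss P Y v =
  \int[P]_w ((v * D w)%:E + ((1 - p)^-1 * Num.max (Y w - v) 0)%:E))%E.
  rewrite integralD//; [|exact: (integrableZl measurableT v iD)|
    exact: (integrableZl measurableT ((1 - p)^-1) ie)].
  under [X in _ = (X + _)%E]eq_integral do rewrite EFinM.
  under [X in _ = (_ + X)%E]eq_integral do rewrite EFinM.
  by rewrite !integralZl// D1 mule1.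
apply: ae_le_integral => //.
- by apply/measurable_EFinP; exact: measurable_funM.
- by apply: emeasurable_funD; apply/measurable_EFinP; exact: measurable_funM.
apply: filterS Dp => w Dw _; rewrite -EFinD lee_fin.
rewrite -lerBlDl (mulrC v) -mulrBr.
apply: (@le_trans _ _ (D w * Num.max (Y w - v) 0)).
  by rewrite ler_wpM2l// le_max lexx.
by rewrite ler_wpM2r// le_max lexx orbT.
Qed.

Lemma ES_cst c : ES P p (cst c) = c%:E.
Proof.
have mc : measurable_fun setT (cst c : T -> R) by exact: measurable_cst.
apply/eqP; rewrite eq_le; apply/andP; split.
  apply: (le_trans (ES_le_stop_loss P c mc p01)).
  rewrite /stop_loss integral0_eq ?mule0 ?adde0// => w _.
  by rewrite /= subrr maxxx.
apply: le_trans (expectation_le_ES (D := cst 1) _ mc _ _ _) => //.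
- rewrite (eq_integral (cst c%:E)) ?integral_cst//=.
    by rewrite [X in (_ * X)%E]probability_setT mule1.
  by move=> w _; rewrite mul1r.
- by apply: aeW => w; rewrite invf_ge1 ?subr_gt0; case/andP: p01 => ? ?; lra.
- by rewrite (integral_cst P measurableT 1%E) [X in (_ * X)%E]probability_setT mule1.
Qed.

End ES_estimates.

(** * The constant exposure *)

Lemma robust_cm (d : measure_display) (T : measurableType d) (R : realType)
  (P : probability T R) (X : T -> R) (gamma : R -> R) (x0 p : R)
  (Z : set (T -> R)) (pi : (T -> R) -> (T -> R) -> \bar R) :
  0 < p < 1 -> standing P X gamma ->
  (ess_sup P (fun w => (gamma (X w))%:E) <= ((1 - p)^-1)%:E)%E ->
  robust_at (ES P p) (G_cm P X gamma x0) Z pi X.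
Proof.
move=> p01 [mX X0 _ [cg g0] [Eg _]] ess.
have mg : measurable_fun setT gamma by exact: continuous_measurable_fun.
have mgX : measurable_fun setT (gamma \o X) by exact: measurableT_comp.
have ae_g : \forall w \ae P, gamma (X w) <= (1 - p)^-1.
  by move/ess_supP : ess; apply: filterS => w; rewrite lee_fin.
have gX0 w : 0 <= gamma (X w) by exact: ltW.
have Gx0 : G_cm P X gamma x0 (cst x0).
  split; first exact: measurable_cst.
  rewrite /Ex; under eq_integral do rewrite mulrC EFinM.
  rewrite integralZl//; first by move: Eg; rewrite /Ex => ->; rewrite mule1.
  apply/integrableP; split; first exact/measurable_EFinP.
  rewrite (eq_integral (fun w => (gamma (X w))%:E)); last first.
    by move=> w _ /=; rewrite ger0_norm.
  by move: Eg; rewrite /Ex => ->; rewrite ltry.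
exists (cst x0); split => //.
- rewrite [LHS](ES_cst P p01); apply/eqP; rewrite eq_le; apply/andP; split.
    apply: le_ereal_inf_tmp => _ [h [mh Eh] <-].
    apply: (le_trans Eh); apply: (@expectation_le_ES _ _ _ P p p01 (gamma \o X)) => //.
    exact: measurableT_comp.
  apply: ereal_inf_lbound; exists (cst x0) => //; exact: ES_cst.
(* Composing a constant with [Y] forgets [Y], so any radius works. *)
- move=> U /nbhs_singleton UX; exists 1 => // Y _ _; exact: UX.
Qed.

(** * Solving the budget equation by the intermediate value theorem *)

Section thresholds.
Context (d : measure_display) (T : measurableType d) (R : realType)
  (P : probability T R).
Implicit Types (D B F : T -> R).

(** The budget as a function of the cap is 1-Lipschitz because E D = 1, vanishes at 0, and tends to
    E[D B] by dominated convergence. *)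
Lemma exists_cap D B (x0 : R) : measurable_fun setT D -> measurable_fun setT B ->
  (forall w, 0 <= D w) -> (forall w, 0 <= B w) -> (\int[P]_w (D w)%:E = 1)%E ->
  (\int[P]_w (D w * B w)%:E < +oo)%E ->
  0 <= x0 -> (x0%:E < \int[P]_w (D w * B w)%:E)%E ->
  exists2 c, 0 <= c & (\int[P]_w (D w * Num.min (B w) c)%:E = x0%:E)%E.
Proof.
move=> mD mB D0 B0 D1 DBoo x00 x0DB.
(* The absolute value keeps the integrand nonnegative for every real [c], so that continuity can be
   shown on the whole line. *)
pose f (c : R) w := D w * Num.min (B w) `|c|.
have mf c : measurable_fun setT (f c).
  by apply: measurable_funM => //; exact: measurable_minr.
have mDB : measurable_fun setT (fun w => D w * B w) by exact: measurable_funM.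
have f0 c w : 0 <= f c w by rewrite mulr_ge0// le_min B0 normr_ge0.
have fB c w : f c w <= D w * B w by rewrite ler_wpM2l// ge_min lexx.
have If0 c : (0 <= \int[P]_w (f c w)%:E)%E by apply: integral_ge0 => w _; rewrite lee_fin.
have Iff c : (\int[P]_w (f c w)%:E)%E \is a fin_num.
  rewrite ge0_fin_numE//; apply: le_lt_trans DBoo.
  apply: ge0_le_integral => //; [|exact/measurable_EFinP..|];
    by move=> w _; rewrite lee_fin.
pose phi c := fine (\int[P]_w (f c w)%:E)%E.
have phiE c : (\int[P]_w (f c w)%:E = (phi c)%:E)%E by rewrite /phi fineK.
have phi_lip c c' : phi c <= phi c' + `|c - c'|.
  rewrite -lee_fin EFinD -!phiE.
  have -> : (`|c - c'|%:E = \int[P]_w (`|c - c'| * D w)%:E)%E.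
    under eq_integral do rewrite EFinM.
    by rewrite ge0_integralZl_EFin ?D1 ?mule1//;
      [move=> w _; rewrite lee_fin|exact/measurable_EFinP].
  rewrite -ge0_integralD//; last 4 first.
  - by move=> w _; rewrite lee_fin.
  - exact/measurable_EFinP.
  - by move=> w _; rewrite lee_fin mulr_ge0.
  - by apply/measurable_EFinP; exact: measurable_funM.
  apply: ge0_le_integral => //.
  - by move=> w _; rewrite lee_fin.
  - exact/measurable_EFinP.
  - by apply: emeasurable_funD; apply/measurable_EFinP => //; exact: measurable_funM.
  move=> w _; rewrite -EFinD lee_fin (mulrC `|_|) -mulrDr ler_wpM2l//.
  have := ler_normD (c - c') c'; rewrite subrK => h.
  have [_|_] := leP (B w) `|c'|.
    by rewrite ge_min; apply/orP; left; rewrite lerDl.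
  by rewrite ge_min; apply/orP; right; rewrite addrC.
have cphi : continuous phi.
  move=> c; apply/cvgrPdist_lt => e e0; near=> c'.
  apply: (@le_lt_trans _ _ `|c - c'|).
    by rewrite ler_norml; have := phi_lip c c'; have := phi_lip c' c; rewrite (distrC c'); lra.
  near: c'; exact: cvgr_dist_lt.
have [n x0n] : exists n : nat, x0 < phi n%:R.
  have iDB : P.-integrable setT (fun w => (D w * B w)%:E).
    apply/integrableP; split; first exact/measurable_EFinP.
    rewrite (eq_integral (fun w => (D w * B w)%:E))// => w _.
    by rewrite gee0_abs// lee_fin mulr_ge0.
  have cv : (\int[P]_w (f n%:R w)%:E @[n --> \oo] --> \int[P]_w (D w * B w)%:E)%E.
    apply: (@dominated_cvg _ _ _ P setT measurableT _ _ (fun w => (D w * B w)%:E)) => //.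
    - by move=> n; exact/measurable_EFinP.
    - move=> w _; apply: cvg_near_cst; near=> n.
      rewrite /f ger0_norm ?ler0n// min_l//.
      near: n; exact: nbhs_infty_ger.
    - by move=> n w _; rewrite gee0_abs lee_fin.
  apply/not_existsP => h.
  have : (limn (fun n => \int[P]_w (f n%:R w)%:E) <= x0%:E)%E.
    apply: lime_le; first by apply/cvg_ex; eexists; exact: cv.
    by apply: nearW => n; rewrite phiE lee_fin leNgt; apply/negP/h.
  by rewrite (cvg_lim _ cv)// leNgt x0DB.
have phi0 : phi 0 = 0.
  apply/EFin_inj; rewrite -phiE integral0_eq// => w _.
  by rewrite /f normr0 min_r// mulr0.
have [c cn cx0] := @IVT R phi 0 n%:R x0 (ler0n _ _) (continuous_subspaceT cphi)
  ltac:(by rewrite phi0 min_l ?max_r ?x00 ?ltW// (le_lt_trans x00)).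
exists c; first by rewrite (itvP cn).
rewrite -cx0 -phiE; apply: eq_integral => w _.
by rewrite /f ger0_norm ?(itvP cn).
Unshelve. all: by end_near. Qed.

(** As [k] varies, E[F; D > k] is continuous because the only outcomes where the indicator may fail
    to converge lie in the null set [{D = k}]. It equals E F at 0, since D is positive, and tends to
    0 at infinity; strictness of [t < E F] excludes [k = 0]. *)
Lemma exists_threshold D F (t : R) : measurable_fun setT D -> measurable_fun setT F ->
  (forall w, 0 < D w) -> (forall w, 0 <= F w) -> (\int[P]_w (F w)%:E < +oo)%E ->
  (forall k, P [set w | D w = k] = 0%E) ->
  0 < t -> (t%:E < \int[P]_w (F w)%:E)%E ->
  exists2 k, 0 < k & (\int[P]_w (if k < D w then F w else 0)%:E = t%:E)%E.
Proof.
move=> mD mF D0 F0 Foo Dk t0 tF.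
pose f (k : R) w := if k < D w then F w else 0.
have mf k : measurable_fun setT (f k).
  by apply: measurable_fun_ifT => //; exact: measurable_fun_ltr.
have mfE k : measurable_fun setT (EFin \o f k) by exact/measurable_EFinP.
have mFE : measurable_fun setT (EFin \o F) by exact/measurable_EFinP.
have f0 k w : 0 <= f k w by rewrite /f; case: ifP.
have fF k w : f k w <= F w by rewrite /f; case: ifP.
have iF : P.-integrable setT (EFin \o F).
  apply/integrableP; split => //.
  by rewrite (eq_integral (EFin \o F))// => w _; rewrite gee0_abs// lee_fin.
have Iff k : (\int[P]_w (f k w)%:E)%E \is a fin_num.
  rewrite ge0_fin_numE; last by apply: integral_ge0 => w _; rewrite lee_fin.
  apply: le_lt_trans Foo.
  apply: ge0_le_integral => //; [|exact/measurable_EFinP..|];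
    by move=> w _; rewrite lee_fin.
pose psi k := fine (\int[P]_w (f k w)%:E)%E.
have psiE k : (\int[P]_w (f k w)%:E = (psi k)%:E)%E by rewrite /psi fineK.
have cpsi : continuous psi.
  move=> k; apply/continuous_withinNx/cvgr_dnbhsP => u [_ uk]; apply: fine_cvg; rewrite -psiE.
  have ae_cvg : {ae P, forall w, setT w -> (f (u n) w)%:E @[n --> \oo] --> (f k w)%:E}.
    exists [set w | D w = k]; split => //.
      rewrite -[X in measurable X]setTI; have := mD measurableT [set k].
      by apply; exact: measurable_set1.
    move=> w; apply: contra_notP => /eqP/= Dwk _; apply: cvg_near_cst; near=> n.
    rewrite /f; congr EFin; suff -> : (u n < D w) = (k < D w) by [].
    near: n; case: (ltgtP k (D w)) Dwk => // kD _.
      by apply: filterS (cvgr_lt _ uk _ kD) => n ->.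
    by apply: filterS (cvgr_gt _ uk _ kD) => n un; apply/negbTE; rewrite -leNgt ltW.
  have ae_le : {ae P, forall w n, setT w -> `|(f (u n) w)%:E| <= (EFin \o F) w}%E.
    by apply: aeW => w n _; rewrite gee0_abs lee_fin.
  by have [_ _] := @dominated_convergence _ _ _ P setT measurableT
    (fun n w => (f (u n) w)%:E) _ _ (fun n => mfE (u n)) (mfE k) ae_cvg iF ae_le.
have psi0 : (\int[P]_w (F w)%:E = (psi 0)%:E)%E.
  by rewrite -psiE; apply: eq_integral => w _; rewrite /f D0.
have [n nt] : exists n : nat, psi n%:R < t.
  have cv : (\int[P]_w (f n%:R w)%:E @[n --> \oo] --> \int[P]_w (cst 0%E w))%E.
    apply: (@dominated_cvg _ _ _ P setT measurableT _ _ (EFin \o F)) => //.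
    - by move=> n; exact/measurable_EFinP.
    - move=> w _; rewrite /cst; apply: cvg_near_cst; near=> n.
      rewrite /f ifF//; apply/negbTE; rewrite -leNgt.
      near: n; exact: nbhs_infty_ger.
    - by move=> n w _; rewrite gee0_abs lee_fin.
  apply/not_existsP => h.
  have : (t%:E <= limn (fun n => \int[P]_w (f n%:R w)%:E))%E.
    apply: lime_ge; first by apply/cvg_ex; eexists; exact: cv.
    by apply: nearW => n; rewrite psiE lee_fin leNgt; apply/negP/h.
  by rewrite (cvg_lim _ cv)// integral0 lee_fin leNgt t0.
have t0' : t < psi 0 by rewrite -lte_fin -psi0.
have [k kn kt] := @IVT R psi 0 n%:R t (ler0n _ _) (continuous_subspaceT cpsi)
  ltac:(by rewrite min_r ?max_l ?ltW// (lt_trans nt)).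
exists k; last by rewrite -kt -psiE.
rewrite lt_neqAle (itvP kn) andbT eq_sym; apply/eqP => k0.
by move: t0'; rewrite -kt k0 ltxx.
Unshelve. all: by end_near. Qed.

End thresholds.

(** * Comparison of stop-losses and Neyman-Pearson inequalities *)

Lemma measurable_fun_mem (d : measure_display) (T : measurableType d) (R : realType)
  (C : set R) (Y : T -> R) : measurable C -> measurable_fun setT Y ->
  measurable_fun setT (fun w => Y w \in C).
Proof.
move=> mC mY; apply: (measurable_fun_bool true); rewrite setTI.
rewrite (_ : _ @^-1` _ = Y @^-1` C); first by rewrite -[Y @^-1` C]setTI; exact: mY.
by apply/seteqP; split => x /=; [exact: set_mem|exact: mem_set].
Qed.

(** [k] is a Lagrange multiplier: [Z] minimizes k (excess) - D (exposure) outcome by outcome and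
    spends the budget exactly, so after integration the budget terms can be cancelled against
    [x0]. *)
Lemma stop_loss_le_of_pointwise (d : measure_display) (T : measurableType d)
  (R : realType) (P : probability T R) (D Y Z : T -> R) (k c x0 : R) :
  measurable_fun setT D -> measurable_fun setT Y -> measurable_fun setT Z ->
  (forall w, 0 <= D w) -> (forall w, 0 <= Y w) -> (forall w, 0 <= Z w) -> 0 < k ->
  (forall w, k * Num.max (Z w - c) 0 + D w * Y w <=
             k * Num.max (Y w - c) 0 + D w * Z w) ->
  (\int[P]_w (D w * Z w)%:E = x0%:E)%E -> (x0%:E <= \int[P]_w (D w * Y w)%:E)%E ->
  (stop_loss P Z c <= stop_loss P Y c)%E.
Proof.
move=> mD mY mZ D0 Y0 Z0 k0 kYZ DZ DY.
have e0 (V : T -> R) w : (0 <= (k * Num.max (V w - c) 0)%:E)%E.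
  by rewrite lee_fin mulr_ge0 ?(ltW k0)// le_max lexx orbT.
have D0' (V : T -> R) : (forall w, 0 <= V w) -> forall w, (0 <= (D w * V w)%:E)%E.
  by move=> V0 w; rewrite lee_fin mulr_ge0.
have me (V : T -> R) : measurable_fun setT V ->
    measurable_fun setT (fun w => (k * Num.max (V w - c) 0)%:E).
  by move=> mV; apply/measurable_EFinP; apply: measurable_funM => //; exact: measurable_excess.
have mM (V : T -> R) : measurable_fun setT V ->
    measurable_fun setT (fun w => (D w * V w)%:E).
  by move=> mV; apply/measurable_EFinP; exact: measurable_funM.
have sE (V : T -> R) : measurable_fun setT V ->
    (\int[P]_w (k * Num.max (V w - c) 0)%:E = k%:E * stop_loss P V c)%E.
  move=> mV; under eq_integral do rewrite EFinM.
  rewrite ge0_integralZl_EFin ?ltW//.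
    by move=> w _; rewrite lee_fin le_max lexx orbT.
  by apply/measurable_EFinP; exact: measurable_excess.
rewrite -(@lee_pmul2l _ k%:E) ?lte_fin// -(@leeD2rE _ x0%:E)//.
apply: (@le_trans _ _ (k%:E * stop_loss P Z c + \int[P]_w (D w * Y w)%:E)%E).
  by rewrite leeD2l.
rewrite -DZ -!sE// -!ge0_integralD//;
  [|exact: me|by move=> w _; exact: D0'|exact: mM|exact: me|by move=> w _; exact: D0'|exact: mM].
apply: ge0_le_integral => //.
- by move=> w _; rewrite adde_ge0// D0'.
- by apply: emeasurable_funD; [exact: me|exact: mM].
- by apply: emeasurable_funD; [exact: me|exact: mM].
- by move=> w _; rewrite -!EFinD lee_fin.
Qed.

Lemma stop_loss_lip (d : measure_display) (T : measurableType d)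
  (R : realType) (P : probability T R) (Y : T -> R) (c c' : R) :
  measurable_fun setT Y -> (stop_loss P Y c <= stop_loss P Y c' + `|c - c'|%:E)%E.
Proof.
move=> mY.
have -> : (`|c - c'|%:E = \int[P]_w (cst `|c - c'|%:E w))%E.
  by rewrite integral_cst//= [X in (_ * X)%E]probability_setT mule1.
rewrite /stop_loss -ge0_integralD//; last 3 first.
- by move=> w _; rewrite lee_fin le_max lexx orbT.
- by apply/measurable_EFinP; exact: measurable_excess.
- by move=> w _; rewrite lee_fin.
apply: ge0_le_integral => //.
- by move=> w _; rewrite lee_fin le_max lexx orbT.
- by apply/measurable_EFinP; exact: measurable_excess.
- by apply: emeasurable_funD => //; apply/measurable_EFinP; exact: measurable_excess.
move=> w _; rewrite -EFinD lee_fin ge_max; apply/andP; split; last first.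
  by rewrite addr_ge0// le_max lexx orbT.
have : Y w - c' <= Num.max (Y w - c') 0 by rewrite le_max lexx.
by have := ler_norm (c' - c); rewrite distrC; lra.
Qed.

Lemma VaR_ge0 (d : measure_display) (T : measurableType d)
  (R : realType) (P : probability T R) (Y : T -> R) (u : R) :
  measurable_fun setT Y -> 0 < u < 1 -> (forall w, 0 <= Y w) -> 0 <= VaR P u Y.
Proof.
move=> mY u01 Y0; rewrite leNgt; apply/negP => v0.
have := lexx (VaR P u Y); rewrite (VaR_le_cdf P _ mY u01).
rewrite (_ : [set _ | _] = set0) ?measure0 ?lee_fin ?leNgt; last first.
  apply/seteqP; split => // w /= Yv.
  by have := le_lt_trans (le_trans (Y0 w) Yv) v0; rewrite ltxx.
by case/andP: u01 => ->.
Qed.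

(** Common form of [G_ns] and [G_bd]; [b] will be the positive part in the first case and the
    constant [m] in the second. *)
Definition G_le (d : measure_display) (T : measurableType d) (R : realType)
  (P : probability T R) (X : T -> R) (gamma b : R -> R) (x0 : R) : set (R -> R) :=
  [set g | [/\ measurable_fun setT g,
           (x0%:E <= Ex P (fun w => (gamma (X w) * g (X w))%R))%E &
           forall w, 0 <= g (X w) <= b (X w)]].

(** Covers both kinds of optimizer: [A] is a superlevel set of [gamma], or empty for the plain cap
    min(b, c). *)
Definition cap_off (R : realType) (b : R -> R) (A : set R) (c x : R) : R :=
  if x \in A then b x else Num.min (b x) c.

(* [X] avoids the boundary of [A] almost surely; the open set [B] stands for the
   exterior of [A]. *)
Definition continuity_set (d : measure_display) (T : measurableType d)
  (R : realType) (P : probability T R) (X : T -> R) (A : set R) : Prop :=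
  open A /\ exists B : set R,
    [/\ open B, A `&` B = set0 & P (X @^-1` (A `|` B)) = 1%E].

Lemma continuity_set0 (d : measure_display) (T : measurableType d)
  (R : realType) (P : probability T R) (X : T -> R) : continuity_set P X set0.
Proof.
split; first exact: open0.
exists setT; split; [exact: openT|by rewrite set0I|].
by rewrite set0U preimage_setT probability_setT.
Qed.

(** The excess is 1-Lipschitz, so raising [y] to [b] costs at most k (b - y), while it earns g (b -
    y) of budget. *)
Lemma neyman_pearson_above (R : realType) (k g y b c : R) : 0 <= k <= g -> y <= b ->
  k * Num.max (b - c) 0 + g * y <= k * Num.max (y - c) 0 + g * b.
Proof.
move=> /andP[k0 kg] yb.
have h1 : Num.max (b - c) 0 - Num.max (y - c) 0 <= b - y.
  by have [?|?] := leP (b - c) 0; have [?|?] := leP (y - c) 0; lra.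
have h2 : k * (Num.max (b - c) 0 - Num.max (y - c) 0) <= k * (b - y) by rewrite ler_wpM2l.
have h3 : k * (b - y) <= g * (b - y) by rewrite ler_wpM2r// subr_ge0.
lra.
Qed.

(** Replacing [y] by min(b, c) removes all the excess and gives up at most (y - c)^+ of exposure,
    whose budget value [g] per unit is at most the price [k]. *)
Lemma neyman_pearson_below (R : realType) (k g y b c : R) : 0 <= g <= k -> y <= b ->
  k * Num.max (Num.min b c - c) 0 + g * y <= k * Num.max (y - c) 0 + g * Num.min b c.
Proof.
move=> /andP[g0 gk] yb; rewrite [X in k * X + _]max_r; last first.
  by rewrite subr_le0 ge_min lexx orbT.
have h1 : y <= Num.max (y - c) 0 + Num.min b c.
  by have [?|?] := leP (y - c) 0; have [?|?] := leP b c; lra.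
have h2 : g * y <= g * (Num.max (y - c) 0 + Num.min b c) by rewrite ler_wpM2l.
have h3 : g * Num.max (y - c) 0 <= k * Num.max (y - c) 0.
  by rewrite ler_wpM2r// le_max lexx orbT.
lra.
Qed.

(** Since (t - c)^+ = t - min(t, c), the claim for [k > 0] amounts to min(y, c) <= min(b, c):
    capping at [c1 >= c] does not change min(b, c). *)
Lemma neyman_pearson_cap (R : realType) (k y b c c1 : R) : 0 <= k -> y <= b -> c <= c1 ->
  k * Num.max (Num.min b c1 - c) 0 + k * y <= k * Num.max (y - c) 0 + k * Num.min b c1.
Proof.
move=> k0 yb cc1; rewrite -!mulrDr ler_wpM2l//.
by have [?|?] := leP b c1; have [?|?] := leP (y - c) 0;
  [have [?|?] := leP (b - c) 0|have [?|?] := leP (b - c) 0|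
   have [?|?] := leP (c1 - c) 0|have [?|?] := leP (c1 - c) 0]; lra.
Qed.

(** Applied with F = gamma(X) b(X): only this product is known to be integrable, and [k] bounds
    [gamma] from below wherever the exposure exceeds the level. *)
Lemma stop_loss_lty (d : measure_display) (T : measurableType d)
  (R : realType) (P : probability T R) (F Z : T -> R) (k c : R) :
  measurable_fun setT F -> measurable_fun setT Z -> 0 < k ->
  (forall w, k * Num.max (Z w - c) 0 <= F w) -> (\int[P]_w (F w)%:E < +oo)%E ->
  (stop_loss P Z c < +oo)%E.
Proof.
move=> mF mZ k0 ZF Foo.
have sk : (stop_loss P Z c <= \int[P]_w (k^-1 * F w)%:E)%E.
  apply: le_integral_fun => //.
  - by apply/measurable_EFinP; exact: measurable_excess.
  - by apply/measurable_EFinP; exact: measurable_funM.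
  - by move=> w _; rewrite lee_fin -ler_pdivrMl ?invr_gt0// invrK.
apply: (le_lt_trans sk); under eq_integral do rewrite EFinM.
rewrite ge0_integralZl_EFin ?invr_ge0 ?(ltW k0)//.
- by rewrite lte_mul_pinfty// lee_fin invr_ge0 ltW.
- move=> w _; rewrite lee_fin (le_trans _ (ZF w))// mulr_ge0 ?(ltW k0)//.
  by rewrite le_max lexx orbT.
- exact/measurable_EFinP.
Qed.

Lemma EVT_min_lipschitz (R : realType) (f : R -> R) (a b K : R) : a <= b -> 0 < K ->
  (forall x y, a <= x <= b -> a <= y <= b -> f x <= f y + K * `|x - y|) ->
  exists2 c, a <= c <= b & forall x, a <= x <= b -> f c <= f x.
Proof.
move=> ab K0 flip.
suff /(EVT_min ab)[c] : {within `[a, b], continuous f}.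
  by rewrite in_itv/= => cab min_c; exists c.
apply/subspace_continuousP => x /=; rewrite in_itv/= => xab.
apply/cvgrPdist_lt => e e0; near=> y.
have yab : a <= y <= b.
  suff : [set` `[a, b]] y by rewrite /= in_itv.
  by near: y; exact: withinT.
have xy : `|x - y| < e / K.
  near: y; apply: cvg_within; apply: (@nbhsx_ballx _ _ x (e / K)).
  by rewrite divr_gt0.
rewrite ltr_pdivlMr// mulrC in xy.
rewrite ltr_norml; have := flip _ _ xab yab; have := flip _ _ yab xab.
by rewrite (distrC y) /from_subspace; lra.
Unshelve. all: by end_near. Qed.

(** * Existence of an optimal exposure *)

Section optimal_exposure.
Context (d : measure_display) (T : measurableType d) (R : realType)
  (P : probability T R) (X : T -> R) (gamma b : R -> R) (x0 p : R).
Hypothesis p01 : 0 < p < 1.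
Hypothesis mX : measurable_fun setT X.
Hypothesis cgamma : continuous gamma.
Hypothesis gamma0 : forall x, 0 < gamma x.
Hypothesis Egamma : (\int[P]_w (gamma (X w))%:E = 1)%E.
Hypothesis mb : measurable_fun setT b.
Hypothesis b0 : forall x, 0 <= b x.
Hypothesis gamma_b_lty : (\int[P]_w (gamma (X w) * b (X w))%:E < +oo)%E.
Hypothesis x00 : 0 <= x0.
Hypothesis x0_lt : (x0%:E < \int[P]_w (gamma (X w) * b (X w))%:E)%E.
Hypothesis gammaP : (exists c, forall x, gamma x = c) \/
  (forall c, P [set w | gamma (X w) = c] = 0%E).

Let mgamma : measurable_fun setT gamma.
Proof. exact: continuous_measurable_fun. Qed.
Let mD : measurable_fun setT (fun w => gamma (X w)).
Proof. exact: measurableT_comp. Qed.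
Let mB : measurable_fun setT (fun w => b (X w)).
Proof. exact: measurableT_comp. Qed.
Let D0 w : 0 <= gamma (X w). Proof. exact: ltW. Qed.

Lemma measurable_cap_off A c : open A -> measurable_fun setT (cap_off b A c).
Proof.
move=> oA; apply: measurable_fun_ifT => //; last exact: measurable_minr.
by apply: measurable_fun_mem => //; exact: open_measurable.
Qed.

Lemma cap_off_ge0 A c x : 0 <= c -> 0 <= cap_off b A c x <= b x.
Proof.
move=> c0; rewrite /cap_off; case: ifP => _; first by rewrite lexx b0.
by rewrite le_min b0 c0 ge_min lexx.
Qed.

Lemma G_le_cap c : 0 <= c ->
  (\int[P]_w (gamma (X w) * Num.min (b (X w)) c)%:E = x0%:E)%E ->
  G_le P X gamma b x0 (cap_off b set0 c).
Proof.
move=> c0 cx0; split; first by apply: measurable_cap_off; exact: open0.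
- rewrite /Ex -cx0 le_eqVlt; apply/orP; left; apply/eqP.
  by apply: eq_integral => w _; rewrite /cap_off in_set0.
- by move=> w; exact: cap_off_ge0.
Qed.

(* Neyman-Pearson: at a fixed level [c] of the Rockafellar-Uryasev functional,
   the whole bound [b] should be used where [gamma] is large. *)
Lemma level_optimal c1 c : 0 <= c1 ->
  (\int[P]_w (gamma (X w) * Num.min (b (X w)) c1)%:E = x0%:E)%E -> 0 <= c <= c1 ->
  exists A c', let g := cap_off b A c' in
  [/\ continuity_set P X A, 0 <= c', G_le P X gamma b x0 g,
      (stop_loss P (g \o X) c < +oo)%E &
      forall h, G_le P X gamma b x0 h ->
        (stop_loss P (g \o X) c <= stop_loss P (h \o X) c)%E].
Proof.
move=> c10 c1x0 /andP[c0 cc1].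
have mGh h : G_le P X gamma b x0 h -> measurable_fun setT (h \o X).
  by case=> mh _ _; exact: measurableT_comp.
have mDB : measurable_fun setT (fun w => gamma (X w) * b (X w)) by exact: measurable_funM.
have mmin r : measurable_fun setT (fun w => Num.min (b (X w)) r) by exact: measurable_minr.
have capE r w : (cap_off b set0 r \o X) w = Num.min (b (X w)) r.
  by rewrite /= /cap_off in_set0.
case: gammaP => [[k gk]|atomless].
  have k0 : 0 < k by rewrite -(gk 0).
  have Gc1 := G_le_cap c10 c1x0.
  exists set0, c1; split => //; first exact: continuity_set0.
    apply: (stop_loss_lty mDB (mGh _ Gc1) k0 _ gamma_b_lty) => w.
    rewrite capE gk ler_wpM2l ?(ltW k0)// ge_max b0 andbT.
    by rewrite lerBlDr ge_min lerDl c0.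
  move=> h Gh; have [_ Eh hb] := Gh.
  apply: (stop_loss_le_of_pointwise mD (mGh _ Gh) (mGh _ Gc1) D0 _ _ k0 _ _ Eh).
  - by move=> w; case/andP: (hb w).
  - by move=> w; case/andP: (cap_off_ge0 set0 (X w) c10).
  - move=> w; rewrite capE gk neyman_pearson_cap ?(ltW k0)//.
    by case/andP: (hb w).
  - by rewrite -c1x0; apply: eq_integral => w _; rewrite capE.
pose phi := fine (\int[P]_w (gamma (X w) * Num.min (b (X w)) c)%:E)%E.
have min0 w : 0 <= gamma (X w) * Num.min (b (X w)) c by rewrite mulr_ge0// le_min b0 c0.
have mmin' r : measurable_fun setT (fun w => (gamma (X w) * Num.min (b (X w)) r)%:E).
  by apply/measurable_EFinP; exact: measurable_funM.
have phi_x0 : (\int[P]_w (gamma (X w) * Num.min (b (X w)) c)%:E <= x0%:E)%E.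
  rewrite -c1x0; apply: le_integral_fun => // w _; rewrite lee_fin ler_wpM2l//.
  by rewrite le_min ge_min lexx/= ge_min cc1 orbT.
have phiE : (\int[P]_w (gamma (X w) * Num.min (b (X w)) c)%:E = phi%:E)%E.
  rewrite /phi fineK// ge0_fin_numE; first exact: le_lt_trans phi_x0 (ltry _).
  by apply: integral_ge0 => w _; rewrite lee_fin.
(* If capping at [c] already meets the budget, the stop-loss is 0 and nothing can be better;
   otherwise there is a positive deficit to be earned above [c]. *)
move: phi_x0; rewrite phiE lee_fin le_eqVlt => /predU1P[phi_x0|phi_x0].
  have Gc : G_le P X gamma b x0 (cap_off b set0 c).
    by apply: G_le_cap => //; rewrite phiE phi_x0.
  have s0 : stop_loss P (cap_off b set0 c \o X) c = 0%E.
    rewrite /stop_loss integral0_eq// => w _; congr EFin; apply: max_r.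
    by rewrite capE subr_le0 ge_min lexx orbT.
  exists set0, c; split => //; first exact: continuity_set0.
    by rewrite s0 ltry.
  by move=> h _; rewrite s0 stop_loss_ge0.
(* The budget gained by lifting the cap at [w]; the threshold is chosen so that lifting it on
   [{gamma > k}] earns exactly [x0 - phi]. *)
pose F w := gamma (X w) * (b (X w) - Num.min (b (X w)) c).
have F0 w : 0 <= F w by rewrite mulr_ge0// subr_ge0 ge_min lexx.
have mF : measurable_fun setT F by apply: measurable_funM => //; exact: measurable_funB.
have FE : (\int[P]_w (gamma (X w) * b (X w))%:E = phi%:E + \int[P]_w (F w)%:E)%E.
  rewrite -phiE -ge0_integralD//.
  - by apply: eq_integral => w _; rewrite -EFinD -mulrDr (addrC (Num.min _ _)) subrK.
  - by move=> w _; rewrite lee_fin.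
  - by move=> w _; rewrite lee_fin.
  - exact/measurable_EFinP.
have Foo : (\int[P]_w (F w)%:E < +oo)%E.
  apply: le_lt_trans gamma_b_lty; rewrite FE leeDr// lee_fin fine_ge0//.
  by apply: integral_ge0 => w _; rewrite lee_fin.
have tF : ((x0 - phi)%:E < \int[P]_w (F w)%:E)%E.
  by move: x0_lt; rewrite FE EFinB lteBlDl.
have [k k0 kE] := exists_threshold mD mF (fun w => gamma0 (X w)) F0 Foo atomless
  (etrans (subr_gt0 _ _) phi_x0) tF.
pose A : set R := gamma @^-1` [set x | k < x]; pose B : set R := gamma @^-1` [set x | x < k].
have oA : open A by apply: open_comp => [x _|]; [exact: cgamma|exact: open_gt].
have oB : open B by apply: open_comp => [x _|]; [exact: cgamma|exact: open_lt].
have inA x : (x \in A) = (k < gamma x) by apply/idP/idP; rewrite inE.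
have mg := measurable_cap_off c oA.
have gE : (\int[P]_w (gamma (X w) * cap_off b A c (X w))%:E = x0%:E)%E.
  transitivity (phi%:E + (x0 - phi)%:E)%E; last by rewrite -EFinD addrC subrK.
  rewrite -kE -phiE -ge0_integralD//.
  - apply: eq_integral => w _; rewrite -EFinD /cap_off inA /F.
    case: ifPn => _; last by rewrite addr0.
    by rewrite -mulrDr (addrC (Num.min _ _)) subrK.
  - by move=> w _; rewrite lee_fin.
  - by move=> w _; rewrite lee_fin; case: ifP.
  - apply/measurable_EFinP; apply: measurable_fun_ifT => //.
    exact: measurable_fun_ltr.
have GA : G_le P X gamma b x0 (cap_off b A c).
  by split => // [|w]; [rewrite /Ex gE|exact: cap_off_ge0].
exists A, c; split => //.
- split => //; exists B; split => //.
    by apply/seteqP; split => // x [] /= kx xk; move: (lt_trans kx xk); rewrite ltxx.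
  have -> : X @^-1` (A `|` B) = ~` [set w | gamma (X w) = k].
    apply/seteqP; split => w /=; first by rewrite /A /B /= => -[] /[swap] ->; rewrite ltxx.
    by move/eqP; rewrite neq_lt => /orP[|]; [right|left].
  rewrite probability_setC ?atomless ?sube0//.
  rewrite -[X in measurable X]setTI.
  exact: (mD measurableT (measurable_set1 k)).
- apply: (stop_loss_lty mDB (mGh _ GA) k0 _ gamma_b_lty) => w.
  rewrite /= /cap_off inA; case: ifPn => [kg|_]; last first.
    by rewrite max_r ?mulr0 ?mulr_ge0// subr_le0 ge_min lexx orbT.
  apply: ler_pM; rewrite ?(ltW k0) ?(ltW kg)//; first by rewrite le_max lexx orbT.
  by rewrite ge_max b0 andbT lerBlDr lerDl.
- move=> h Gh; have [_ Eh hb] := Gh.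
  apply: (stop_loss_le_of_pointwise mD (mGh _ Gh) (mGh _ GA) D0 _ _ k0 _ gE Eh).
  + by move=> w; case/andP: (hb w).
  + by move=> w; case/andP: (cap_off_ge0 A (X w) c0).
  + move=> w; case/andP: (hb w) => _ hbw; rewrite /= /cap_off inA.
    case: ifPn => [kg|]; first by apply: neyman_pearson_above; rewrite // (ltW k0) (ltW kg).
    by rewrite -leNgt => gk; apply: neyman_pearson_below; rewrite // D0.
Qed.

(** With [W c] the least Rockafellar-Uryasev value at level [c] and [c] its minimizer, the chain for
    a competitor [h] is ES(G c) <= W(c) <= W(VaR_p(h)) <= ES(h). *)
Lemma exists_optimal_cap_off : exists A c, let g := cap_off b A c in
  [/\ continuity_set P X A, 0 <= c, G_le P X gamma b x0 g,
      ES P p (g \o X) \is a fin_num &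
      ES P p (g \o X) = ereal_inf [set ES P p (h \o X) | h in G_le P X gamma b x0]].
Proof.
have [c1 c10 c1x0] := exists_cap mD mB D0 (fun w => b0 (X w)) Egamma gamma_b_lty x00 x0_lt.
pose Q c (g : R -> R) := [/\ G_le P X gamma b x0 g, (stop_loss P (g \o X) c < +oo)%E &
  forall h, G_le P X gamma b x0 h ->
        (stop_loss P (g \o X) c <= stop_loss P (h \o X) c)%E].
(* The jump set and the cap stay existential: [choice] selects only the function for each level, and
   its shape is recovered once the best level is known. *)
pose S c (g : R -> R) :=
  (exists A c', [/\ g = cap_off b A c', continuity_set P X A & 0 <= c']) /\ Q c g.
have [G GP] : exists G : R -> R -> R, forall c, 0 <= c <= c1 -> S c (G c).
  have /choice[G GP] : forall c, exists g, 0 <= c <= c1 -> S c g.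
    move=> c; have [cc1|_] := boolP (0 <= c <= c1); last by exists b.
    have [A [c' /= [cA c'0 h1 h2 h3]]] := level_optimal c10 c1x0 cc1.
    by exists (cap_off b A c') => _; split => //; exists A, c'.
  by exists G.
have mG (h : R -> R) : G_le P X gamma b x0 h -> measurable_fun setT (h \o X).
  by case=> mh _ _; exact: measurableT_comp.
pose s c := fine (stop_loss P (G c \o X) c).
have sE c : 0 <= c <= c1 -> stop_loss P (G c \o X) c = (s c)%:E.
  by move=> /GP[_ [_ oo _]]; rewrite /s fineK// ge0_fin_numE// stop_loss_ge0.
(* [G c'] competes at level [c], and the stop-loss of this fixed exposure is 1-Lipschitz in the
   level. *)
have s_lip c c' : 0 <= c <= c1 -> 0 <= c' <= c1 -> s c <= s c' + `|c - c'|.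
  move=> cc cc'; have [_ [_ _ opt]] := GP _ cc; have [_ [Gc' _ _]] := GP _ cc'.
  rewrite -lee_fin EFinD -!sE//; apply: (le_trans (opt _ Gc')).
  by apply: stop_loss_lip; exact: mG Gc'.
set a := (1 - p)^-1.
have a0 : 0 < a by rewrite /a invr_gt0 subr_gt0; case/andP: p01.
pose W c := c + a * s c.
have [|x y xc yc|c cc Wmin] := @EVT_min_lipschitz R W 0 c1 (1 + a) c10.
- by rewrite addr_gt0.
- have h : a * s x <= a * (s y + `|x - y|) by rewrite ler_wpM2l ?(ltW a0)// s_lip.
  by rewrite /W; have := ler_norm (x - y); lra.
have [[A [c' [GE cA c'0]]] [Gc _ _]] := GP _ cc.
(* An inequality suffices: [c] is not claimed to be the VaR of [G c]. *)
have up : (ES P p (G c \o X) <= (W c)%:E)%E.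
  rewrite (le_trans (ES_le_stop_loss P c (mG _ Gc) p01))// sE// /W EFinD EFinM lexx.
exists A, c'; rewrite -GE; split => //.
  rewrite fin_numElt (le_lt_trans up (ltry _)) andbT.
  by apply: lt_le_trans (ES_ge_VaR P p01 (mG _ Gc)); exact: ltNyr.
apply/eqP; rewrite eq_le; apply/andP; split; last first.
  by apply: ereal_inf_lbound; exists (G c).
apply: le_ereal_inf_tmp => _ [h Gh <-]; apply: (le_trans up).
have mh := mG _ Gh; set v := VaR P p (h \o X).
have v0 : 0 <= v.
  by apply: VaR_ge0 => // w; case: Gh => _ _ /(_ w)/andP[].
have [vc1|c1v] := leP v c1.
  have vv : 0 <= v <= c1 by rewrite v0 vc1.
  have [_ [_ _ opt]] := GP _ vv.
  rewrite (ES_stop_loss_VaR P mh p01) -/v.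
  apply: (@le_trans _ _ (W v)%:E); first by rewrite lee_fin Wmin.
  rewrite /W EFinD EFinM -sE// leeD2l//; apply: lee_wpmul2l; last exact: opt.
  by rewrite lee_fin ltW.
(* Here the VaR of [h] exceeds [c1]. The cap at [c1] has no excess over [c1], so W(c1) <= c1 <
   VaR_p(h) <= ES(h). *)
apply: le_trans (ES_ge_VaR P p01 mh).
have cc1 : 0 <= c1 <= c1 by rewrite c10 lexx.
have [_ [_ _ opt]] := GP _ cc1.
have s1 : s c1 <= 0.
  rewrite -lee_fin -sE//; apply: (le_trans (opt _ (G_le_cap c10 c1x0))).
  rewrite /stop_loss integral0_eq// => w _; congr EFin; apply: max_r.
  by rewrite /= /cap_off in_set0 subr_le0 ge_min lexx orbT.
rewrite lee_fin (le_trans (Wmin c1 _))//.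
rewrite /W (le_trans _ (ltW c1v))// gerDl.
by rewrite mulr_ge0_le0// ltW.
Unshelve. all: by end_near. Qed.

End optimal_exposure.

(** * Domination of the L^1 norm by the other norms *)

Lemma L1_le_Lnorm (d : measure_display) (T : measurableType d) (R : realType)
  (P : probability T R) (f : T -> R) (q : R) : measurable_fun setT f -> 1 <= q ->
  (\int[P]_w `|f w|%:E <= Lnorm P q%:E (EFin \o f))%E.
Proof.
move=> mf; rewrite le_eqVlt => /predU1P[<-|q1]; first by rewrite Lnorm1.
have q0 : 0 < q by rewrite (lt_trans ltr01).
pose q' := (1 - q^-1)^-1.
have q'0 : 0 < q' by rewrite invr_gt0 subr_gt0 invf_lt1.
have qq' : q^-1 + q'^-1 = 1 by rewrite invrK addrC subrK.
have := @hoelder _ _ _ P f (cst 1) q q' mf (measurable_cst _) q0 q'0 qq'.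
rewrite Lnorm_cst1 [X in (X `^ _)%E]probability_setT poweR1r mule1 Lnorm1.
apply: le_trans; rewrite le_eqVlt; apply/orP; left; apply/eqP.
by apply: eq_integral => w _; rewrite /= mulr1.
Qed.

Lemma L1_le_Lnormy (d : measure_display) (T : measurableType d) (R : realType)
  (P : probability T R) (f : T -> R) : measurable_fun setT f ->
  (\int[P]_w `|f w|%:E <= Lnorm P +oo%E (EFin \o f))%E.
Proof.
move=> mf; rewrite unlock [X in (0 < X)%E]probability_setT lte01.
set M := ess_sup _ _.
have -> : M = (\int[P]_w (cst M w))%E.
  by rewrite integral_cst//= [X in (_ * X)%E]probability_setT mule1.
apply: ae_le_integral => //.
- by apply/measurable_EFinP; exact: measurableT_comp.
- have := ess_sup_ge P (abse \o (EFin \o f)).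
  by apply: filterS => w /= + _.
Qed.

Lemma open_enlarge (R : realType) (A : set R) (e : R) : open (enlarge A e).
Proof.
rewrite (_ : enlarge A e = \bigcup_(y in A) ball y e).
  by apply: bigcup_open => y _; exact: ball_open.
apply/seteqP; split => x [y Ay xy]; exists y => //; move: xy; rewrite /ball/= distrC//.
Qed.

(** Outside this set the ball of radius [e] around the point lies entirely in [A] or entirely in
    [B], so a move shorter than [e] cannot cross the jump. *)
Definition boundary_zone (R : realType) (A B : set R) (e : R) : set R :=
  enlarge (~` A) e `&` enlarge (~` B) e.

Lemma measurable_boundary_zone (R : realType) (A B : set R) (e : R) :
  measurable (boundary_zone A B e).
Proof. by apply: measurableI; apply: open_measurable; exact: open_enlarge. Qed.

Lemma boundary_zoneP (R : realType) (A B : set R) (e x y : R) : A `&` B = set0 ->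
  ~ boundary_zone A B e x -> `|x - y| < e -> (x \in A) = (y \in A).
Proof.
move=> AB; rewrite /boundary_zone => /not_andP[] xC xy.
  have Ay : A y by apply: contrapT => nAy; apply: xC; exists y.
  have Ax : A x.
    apply: contrapT => nAx; apply: xC; exists x => //.
    by rewrite subrr normr0 (le_lt_trans _ xy).
  by rewrite !mem_set.
have By : B y by apply: contrapT => nBy; apply: xC; exists y.
have Bx : B x.
  apply: contrapT => nBx; apply: xC; exists x => //.
  by rewrite subrr normr0 (le_lt_trans _ xy).
have nA z : B z -> z \notin A.
  move=> Bz; apply/negP; rewrite inE => Az.
  by have : (A `&` B) z by []; rewrite AB.
by rewrite (negbTE (nA _ Bx)) (negbTE (nA _ By)).
Qed.

Lemma measurable_switch (d : measure_display) (T : measurableType d) (R : realType)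
  (A : set R) (X Y F : T -> R) : measurable A -> measurable_fun setT X ->
  measurable_fun setT Y -> measurable_fun setT F ->
  measurable_fun setT (fun w => if (X w \in A) == (Y w \in A) then 0 else F w).
Proof.
move=> mA mX mY mF.
rewrite (_ : (fun w => _) = (fun w => if X w \in A then
    (if Y w \in A then 0 else F w) else (if Y w \in A then F w else 0))).
  by apply: measurable_fun_ifT; [exact: measurable_fun_mem|..];
    apply: measurable_fun_ifT => //; exact: measurable_fun_mem.
by apply/funext => w; case: (X w \in A); case: (Y w \in A).
Qed.

(** * Smallness of the contribution of outcomes that cross the jump *)

Section continuity_at.
Context (d : measure_display) (T : measurableType d) (R : realType)
  (P : probability T R) (X : T -> R).
Hypothesis mX : measurable_fun setT X.
Variables (A B : set R).
Hypotheses (oA : open A) (oB : open B) (AB0 : A `&` B = set0)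
  (PAB : P (X @^-1` (A `|` B)) = 1%E).

(** Each point of the open sets [A] and [B] leaves the zone once its width is small, and [X] avoids
    the other points almost surely; dominated convergence concludes. *)
Lemma integral_boundary_zone_small (F : T -> R) (e : R) : measurable_fun setT F ->
  (forall w, 0 <= F w) -> (\int[P]_w (F w)%:E < +oo)%E -> 0 < e ->
  exists2 del, 0 < del &
  (\int[P]_w (if X w \in boundary_zone A B del then F w else 0)%:E < e%:E)%E.
Proof.
move=> mF F0 Foo e0.
pose f n w := if X w \in boundary_zone A B n.+1%:R^-1 then F w else 0.
have mf n : measurable_fun setT (f n).
  apply: measurable_fun_ifT => //; apply: measurable_fun_mem => //.
  exact: measurable_boundary_zone.
have mfE n : measurable_fun setT (EFin \o f n) by exact/measurable_EFinP.
have mFE : measurable_fun setT (EFin \o F) by exact/measurable_EFinP.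
have f0 n w : 0 <= f n w by rewrite /f; case: ifP.
have fF n w : f n w <= F w by rewrite /f; case: ifP.
have iF : P.-integrable setT (EFin \o F).
  apply/integrableP; split => //.
  by rewrite (eq_integral (EFin \o F))// => w _; rewrite gee0_abs// lee_fin.
have mAB : measurable (X @^-1` (A `|` B)).
  rewrite -[X @^-1` _]setTI; apply: mX => //.
  by apply: measurableU; exact: open_measurable.
have away (C : set R) x : open C -> C x ->
    exists2 r, 0 < r & forall y, `|x - y| < r -> C y.
  move=> oC Cx; have /nbhs_ballP[r /= r0 rC] : nbhs x C by exact: open_nbhs_nbhs.
  by exists r => // y xy; exact: rC.
have ae_cvg : {ae P, forall w, setT w -> (f n w)%:E @[n --> \oo] --> (cst 0%E w : \bar R)}.
  exists (~` (X @^-1` (A `|` B))); split => //; first exact: measurableC.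
    by rewrite probability_setC// PAB subee.
  move=> w /=; apply: contra_notP => /contrapT ABw _; rewrite /cst.
  have [r r0 rAB] : exists2 r, 0 < r & (forall y, `|X w - y| < r -> A y) \/
      (forall y, `|X w - y| < r -> B y).
    by case: ABw => /away => /(_ _)[]// r r0 rC; exists r => //; [left|right].
  apply: cvg_near_cst; near=> n.
  rewrite /f ifF//; apply/negbTE/negP; rewrite inE => -[[y Ay xy] [z Bz xz]].
  have nr : n.+1%:R^-1 < r by near: n; exact: near_infty_natSinv_lt (PosNum r0).
  by case: rAB => [/(_ y (lt_trans xy nr))|/(_ z (lt_trans xz nr))].
have ae_le : {ae P, forall w n, setT w -> `|(f n w)%:E| <= (EFin \o F) w}%E.
  by apply: aeW => w n _; rewrite gee0_abs lee_fin.
have [_ _ cv] := @dominated_convergence _ _ _ P setT measurableT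
  (fun n w => (f n w)%:E) _ _ mfE (measurable_cst _) ae_cvg iF ae_le.
apply: contrapT => h.
have : (e%:E <= limn (fun n => \int[P]_w (f n w)%:E))%E.
  apply: lime_ge; first by apply/cvg_ex; eexists; exact: cv.
  apply: nearW => n; rewrite leNgt; apply/negP => fe.
  by apply: h; exists n.+1%:R^-1.
by rewrite (cvg_lim _ cv)// integral0 lee_fin leNgt e0.
Unshelve. all: by end_near. Qed.

Lemma stop_loss_small (F : T -> R) (e : R) : measurable_fun setT F ->
  (forall w, 0 <= F w) -> (\int[P]_w (F w)%:E < +oo)%E -> 0 < e ->
  exists2 M, 0 < M & (stop_loss P F M < e%:E)%E.
Proof.
move=> mF F0 Foo e0.
have mFE : measurable_fun setT (EFin \o F) by exact/measurable_EFinP.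
have iF : P.-integrable setT (EFin \o F).
  apply/integrableP; split => //.
  by rewrite (eq_integral (EFin \o F))// => w _; rewrite gee0_abs// lee_fin.
have cv : (stop_loss P F n.+1%:R @[n --> \oo] --> \int[P]_w (cst 0%E w))%E.
  apply: (@dominated_cvg _ _ _ P setT measurableT _ _ (EFin \o F)) => //.
  - by move=> n; apply/measurable_EFinP; exact: measurable_excess.
  - move=> w _; rewrite /cst; apply: cvg_near_cst; near=> n.
    congr EFin; apply: max_r; rewrite subr_le0 (@le_trans _ _ n%:R) ?ler_nat//.
    near: n; exact: nbhs_infty_ger.
  - move=> n w _; rewrite gee0_abs lee_fin; last by rewrite le_max lexx orbT.
    by rewrite ge_max F0 andbT lerBlDr lerDl.
apply: contrapT => h.
have : (e%:E <= limn (fun n => stop_loss P F n.+1%:R))%E.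
  apply: lime_ge; first by apply/cvg_ex; eexists; exact: cv.
  apply: nearW => n; rewrite leNgt; apply/negP => fe.
  by apply: h; exists n.+1%:R.
by rewrite (cvg_lim _ cv)// integral0 lee_fin leNgt e0.
Unshelve. all: by end_near. Qed.

(** An outcome that switches sides either has [X] in the zone or satisfies |Y - X| >= del, and then
    F <= M + (F - M)^+ <= (M / del) |Y - X| + (F - M)^+. Zone, displacement and tail get [e / 3]
    each, which dictates [eta]. *)
Lemma integral_switch_small (F : T -> R) (e : R) : measurable_fun setT F ->
  (forall w, 0 <= F w) -> (\int[P]_w (F w)%:E < +oo)%E -> 0 < e ->
  exists2 eta : R, 0 < eta & forall Y : T -> R, measurable_fun setT Y ->
  (\int[P]_w `|Y w - X w|%:E < eta%:E)%E ->
  (\int[P]_w (if (X w \in A) == (Y w \in A) then 0 else F w)%:E <= e%:E)%E.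
Proof.
move=> mF F0 Foo e0.
have e3 : 0 < e / 3 by rewrite divr_gt0.
have [M M0 sM] := stop_loss_small mF F0 Foo e3.
have [del del0 sdel] := integral_boundary_zone_small mF F0 Foo e3.
exists (e / 3 / (M / del)); first by rewrite !divr_gt0.
move=> Y mY YX.
pose f1 w := if X w \in boundary_zone A B del then F w else 0.
pose f2 w := M / del * `|Y w - X w|.
pose f3 w := Num.max (F w - M) 0.
have f10 w : 0 <= f1 w by rewrite /f1; case: ifP.
have f20 w : 0 <= f2 w by rewrite mulr_ge0// divr_ge0 ?(ltW M0) ?(ltW del0).
have f30 w : 0 <= f3 w by rewrite le_max lexx orbT.
have mA := open_measurable oA.
have mf1 : measurable_fun setT f1.
  apply: measurable_fun_ifT => //; apply: measurable_fun_mem => //.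
  exact: measurable_boundary_zone.
have mYX : measurable_fun setT (fun w => `|Y w - X w|).
  by apply: measurableT_comp => //; exact: measurable_funB.
have mf2 : measurable_fun setT f2 by exact: measurable_funM.
have mf3 : measurable_fun setT f3 by exact: measurable_excess.
have f2e : (\int[P]_w (f2 w)%:E <= (e / 3)%:E)%E.
  under eq_integral do rewrite EFinM.
  have Mdel : 0 < M / del by rewrite divr_gt0.
  rewrite ge0_integralZl_EFin ?(ltW Mdel)//; last exact/measurable_EFinP.
  apply: (@le_trans _ _ ((M / del)%:E * (e / 3 / (M / del))%:E)%E).
    by apply: lee_wpmul2l; rewrite ?lee_fin ltW.
  by rewrite -EFinM lee_fin mulrC mulfVK// gt_eqF.
apply: (@le_trans _ _ (\int[P]_w ((f1 w)%:E + ((f2 w)%:E + (f3 w)%:E)))%E).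
  apply: le_integral_fun => //.
  - by apply/measurable_EFinP; exact: measurable_switch.
  - by apply: emeasurable_funD; [|apply: emeasurable_funD]; exact/measurable_EFinP.
  move=> w _; rewrite -!EFinD lee_fin.
  case: ifPn => [_|XY]; first by rewrite !addr_ge0.
  rewrite /f1; case: ifPn => [_|]; first by rewrite lerDl addr_ge0.
  rewrite notin_setE => nC; rewrite add0r.
  have dXY : del <= `|Y w - X w|.
    rewrite leNgt distrC; apply/negP => /(boundary_zoneP AB0 nC) h.
    by rewrite h eqxx in XY.
  have h2 : M <= f2 w.
    rewrite /f2 -mulrA ler_peMr ?(ltW M0)//.
    by rewrite mulrC ler_pdivlMr// mul1r.
  have h3 : F w - M <= f3 w by rewrite le_max lexx.
  lra.
rewrite ge0_integralD//; last 4 first.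
- by move=> w _; rewrite lee_fin.
- exact/measurable_EFinP.
- by move=> w _; rewrite -EFinD lee_fin addr_ge0.
- by apply: emeasurable_funD; exact/measurable_EFinP.
rewrite ge0_integralD//; last 4 first.
- by move=> w _; rewrite lee_fin.
- exact/measurable_EFinP.
- by move=> w _; rewrite lee_fin.
- exact/measurable_EFinP.
rewrite (_ : e = e / 3 + (e / 3 + e / 3)); last by lra.
rewrite !EFinD; apply: leeD; first exact: ltW.
by apply: leeD => //; exact: ltW.
Qed.

End continuity_at.

(** * Continuity of ES at the optimizer, in L^1 and for the Prokhorov distance *)

Lemma stop_loss_le_L1 (d : measure_display) (T : measurableType d) (R : realType)
  (P : probability T R) (Y Z F : T -> R) (c : R) : measurable_fun setT Y ->
  measurable_fun setT Z -> measurable_fun setT F -> (forall w, `|Y w - Z w| <= F w) ->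
  (stop_loss P Y c <= stop_loss P Z c + \int[P]_w (F w)%:E)%E.
Proof.
move=> mY mZ mF YZF.
rewrite /stop_loss -ge0_integralD//; last 4 first.
- by move=> w _; rewrite lee_fin le_max lexx orbT.
- by apply/measurable_EFinP; exact: measurable_excess.
- by move=> w _; rewrite lee_fin (le_trans _ (YZF w)).
- exact/measurable_EFinP.
apply: le_integral_fun => //.
- by apply/measurable_EFinP; exact: measurable_excess.
- by apply: emeasurable_funD; apply/measurable_EFinP => //; exact: measurable_excess.
move=> w _; rewrite -EFinD lee_fin ge_max; apply/andP; split; last first.
  by rewrite addr_ge0 ?(le_trans _ (YZF w))// le_max lexx orbT.
have : Z w - c <= Num.max (Z w - c) 0 by rewrite le_max lexx.
by have := ler_norm (Y w - Z w); have := YZF w; lra.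
Qed.

(** The jump is charged to [b x] alone, since b y <= b x + |y - x|. With x = X(w), the bound on its
    height does not depend on the perturbation [Y]. *)
Lemma cap_off_dist (R : realType) (b : R -> R) (A : set R) (c x y : R) :
  (forall u v, `|b u - b v| <= `|u - v|) -> (forall u, 0 <= b u) -> 0 <= c ->
  `|cap_off b A c y - cap_off b A c x| <=
  `|y - x| + (if (x \in A) == (y \in A) then 0 else b x).
Proof.
move=> blip b0 c0; have := blip y x; rewrite ler_norml => /andP[h1 h2].
have := b0 x; have := b0 y => hx hy; rewrite ler_norml /cap_off.
by case: (x \in A); case: (y \in A) => /=;
  have [?|?] := leP (b x) c; have [?|?] := leP (b y) c; lra.
Qed.

Section continuity_of_ES.
Context (d : measure_display) (T : measurableType d) (R : realType)
  (P : probability T R) (X : T -> R) (p : R).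
Hypotheses (p01 : 0 < p < 1) (mX : measurable_fun setT X).

Lemma ES_cap_off_continuous_L1 (b : R -> R) (A : set R) (c : R) (U : set (\bar R)) :
  measurable_fun setT b -> (forall u v, `|b u - b v| <= `|u - v|) ->
  (forall u, 0 <= b u) -> (\int[P]_w (b (X w))%:E < +oo)%E ->
  continuity_set P X A -> 0 <= c ->
  let g := cap_off b A c in
  ES P p (g \o X) \is a fin_num -> nbhs (ES P p (g \o X)) U ->
  exists2 del : R, 0 < del & forall Y : T -> R, measurable_fun setT Y ->
    (\int[P]_w `|Y w - X w|%:E < del%:E)%E -> U (ES P p (g \o Y)).
Proof.
move=> mb blip b0 boo [oA [B [oB AB0 PAB]]] c0 g gfin gU.
have mg : measurable_fun setT g by exact: measurable_cap_off.
have mgY (Y : T -> R) : measurable_fun setT Y -> measurable_fun setT (g \o Y).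
  by move=> mY; exact: measurableT_comp.
have mbX : measurable_fun setT (b \o X) by exact: measurableT_comp.
have [e e0 eU] := nbhs_ES p01 (mgY _ mX) gfin gU.
have e2 : 0 < e / 2 by rewrite divr_gt0.
have [eta eta0 etaP] := integral_switch_small mX oA oB AB0 PAB mbX (fun w => b0 (X w)) boo e2.
(* One half of [e] pays for the displacement, the other for the outcomes that switch sides. *)
exists (Num.min eta (e / 2)); first by rewrite lt_min eta0.
move=> Y mY YX.
have mYX : measurable_fun setT (fun w => `|Y w - X w|).
  by apply: measurableT_comp => //; exact: measurable_funB.
have msw := measurable_switch (open_measurable oA) mX mY mbX.
pose F w := `|Y w - X w| + (if (X w \in A) == (Y w \in A) then 0 else b (X w)).
have mF : measurable_fun setT F by exact: measurable_funD.
have Fe : (\int[P]_w (F w)%:E <= e%:E)%E.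
  rewrite /F; under eq_integral do rewrite EFinD.
  rewrite ge0_integralD//; last 3 first.
  - exact/measurable_EFinP.
  - by move=> w _; rewrite lee_fin; case: ifP.
  - exact/measurable_EFinP.
  rewrite (_ : e = e / 2 + e / 2); last by lra.
  rewrite EFinD; apply: leeD.
    by apply: le_trans (ltW YX) _; rewrite lee_fin ge_min lexx orbT.
  by apply: etaP => //; apply: lt_le_trans YX _; rewrite lee_fin ge_min lexx.
have FYX w : `|(g \o Y) w - (g \o X) w| <= F w by exact: cap_off_dist.
apply: eU; first exact: mgY.
  move=> c'; apply: le_trans (stop_loss_le_L1 P c' (mgY _ mY) (mgY _ mX) mF FYX) _.
  by rewrite leeD2l.
move=> c'; apply: le_trans (stop_loss_le_L1 P c' (mgY _ mX) (mgY _ mY) mF _) _.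
  by move=> w; rewrite distrC.
by rewrite leeD2l.
Qed.

Lemma stop_loss_cap_off_cst (m c c' : R) (A : set R) (Y : T -> R) :
  measurable A -> measurable_fun setT Y ->
  let beta := Num.max (Num.min m c - c') 0 in
  stop_loss P (cap_off (cst m) A c \o Y) c' =
  (beta + (Num.max (m - c') 0 - beta) * fine (P (Y @^-1` A)))%:E.
Proof.
move=> mA mY beta.
have mYA : measurable (Y @^-1` A) by rewrite -[Y @^-1` A]setTI; exact: mY.
set al := Num.max (m - c') 0.
have ab : 0 <= al - beta.
  rewrite subr_ge0 ge_max !le_max lexx orbT andbT.
  by apply/orP; left; rewrite lerD2r ge_min lexx.
rewrite /stop_loss.
rewrite (eq_integral (fun w => (beta + (al - beta) * \1_(Y @^-1` A) w)%:E)); last first.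
  move=> w _; rewrite /= /cap_off indicE; congr EFin.
  rewrite (_ : (w \in _) = (Y w \in A)).
    by case: ifP => _ /=; rewrite ?mulr1 ?mulr0 ?addr0 -?[Num.max (m - c') 0]/al//; lra.
  by apply/idP/idP; rewrite !inE.
rewrite integral_cstD//; last 3 first.
- by rewrite [ltLHS]probability_setT ltry.
- by apply: measurable_funM => //; exact: measurable_indic.
- by move=> w _; rewrite mulr_ge0// indicE.
rewrite [X in (_ * X)%E]probability_setT mule1.
under eq_integral do rewrite EFinM.
rewrite ge0_integralZl_EFin//.
- by rewrite integral_indic// setIT [RHS]EFinD [in RHS]EFinM fineK// fin_num_measure.
- by apply/measurable_EFinP; exact: measurable_indic.
Qed.

(** A portmanteau argument: enlarging [A] or its complement by less than the zone width adds only
    zone points, so the bound on P(Y in S) by the law of [X] is applied to both sets; the complement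
    yields the reverse inequality. *)
Lemma prokhorov_continuity_set (A : set R) (t : R) : continuity_set P X A -> 0 < t ->
  exists2 del : R, 0 < del & forall Y : T -> R, measurable_fun setT Y ->
    (prokhorov P Y X < del%:E)%E ->
    `|fine (P (Y @^-1` A)) - fine (P (X @^-1` A))| <= t.
Proof.
move=> [oA [B [oB AB0 PAB]]] t0; have mA := open_measurable oA.
have t2 : 0 < t / 2 by rewrite divr_gt0.
(* With F = 1 the integral is the probability of the zone. It takes [t / 2]; the additive term of
   the Prokhorov condition takes the rest. *)
have [|del0 del00 zone] := integral_boundary_zone_small mX oA oB PAB
  (measurable_cst (1 : R)) (fun=> ler01) _ t2.
  by rewrite (integral_cst P measurableT 1%E) [X in (_ * X)%E]probability_setT mule1 ltry.
set C := boundary_zone A B del0 in zone.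
have mC : measurable C by exact: measurable_boundary_zone.
have mpre (Y : T -> R) (S : set R) : measurable_fun setT Y -> measurable S ->
    measurable (Y @^-1` S).
  by move=> mY mS; rewrite -[Y @^-1` S]setTI; exact: mY.
have PC : (P (X @^-1` C) <= (t / 2)%:E)%E.
  apply: le_trans (ltW zone).
  have <- : (\int[P]_w (\1_(X @^-1` C) w)%:E = P (X @^-1` C))%E.
    by rewrite integral_indic ?setIT//; exact: mpre.
  rewrite le_eqVlt; apply/orP; left; apply/eqP; apply: eq_integral => w _.
  rewrite indicE (_ : (w \in _) = (X w \in C)); last by apply/idP/idP; rewrite !inE.
  by case: ifP.
exists (Num.min del0 (t / 2)); first by rewrite lt_min del00.
move=> Y mY /ereal_inf_lt[_ [e' [e'0 prok] <-]]; rewrite lte_fin lt_min => /andP[e'd e't].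
have PE (Z : T -> R) (S : set R) : measurable_fun setT Z -> measurable S ->
    P (Z @^-1` S) = (fine (P (Z @^-1` S)))%:E.
  by move=> mZ mS; rewrite fineK// fin_num_measure//; exact: mpre.
have step (S : set R) : measurable S -> (enlarge S e' `<=` S `|` C) ->
    fine (P (Y @^-1` S)) <= fine (P (X @^-1` S)) + t.
  move=> mS SC; rewrite -lee_fin EFinD -!PE//.
  apply: (le_trans (prok S mS).1).
  apply: (@le_trans _ _ (P (X @^-1` S) + P (X @^-1` C) + e'%:E)%E).
    rewrite leeD2r//; apply: (@le_trans _ _ (P (X @^-1` (S `|` C)))).
      apply: le_measure; rewrite ?inE.
      - by apply: mpre => //; apply: open_measurable; exact: open_enlarge.
      - by apply: mpre => //; exact: measurableU.
      - exact: preimage_subset.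
    by rewrite preimage_setU; apply: measureU2; exact: mpre.
  rewrite -addeA leeD2l// (_ : t = t / 2 + t / 2); last by lra.
  by rewrite EFinD leeD// lee_fin ltW.
have zoneE x y : ~ C x -> `|x - y| < e' -> (x \in A) = (y \in A).
  by move=> nC xy; apply: (boundary_zoneP AB0 nC); exact: lt_trans e'd.
have hA := step A mA; have hC := step (~` A) (measurableC mA).
have PN (Z : T -> R) : measurable_fun setT Z ->
    fine (P (Z @^-1` (~` A))) = 1 - fine (P (Z @^-1` A)).
  move=> mZ; rewrite preimage_setC probability_setC; last exact: mpre.
  by rewrite PE// -EFinB.
rewrite !PN// in hC.
have {}hA : fine (P (Y @^-1` A)) <= fine (P (X @^-1` A)) + t.
  apply: hA => x [y Ay xy]; have [Cx|nCx] := pselect (C x); first by right.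
  by left; apply: set_mem; rewrite (zoneE _ _ nCx xy) mem_set.
have {}hC : 1 - fine (P (Y @^-1` A)) <= 1 - fine (P (X @^-1` A)) + t.
  apply: hC => x [y nAy xy]; have [Cx|nCx] := pselect (C x); first by right.
  by left => Ax; apply: nAy; apply: set_mem; rewrite -(zoneE _ _ nCx xy) mem_set.
by rewrite ler_norml; lra.
Qed.

Lemma ES_cap_off_continuous_prokhorov (m c : R) (A : set R) (U : set (\bar R)) :
  0 < m -> continuity_set P X A -> 0 <= c ->
  let g := cap_off (cst m) A c in
  ES P p (g \o X) \is a fin_num -> nbhs (ES P p (g \o X)) U ->
  exists2 del : R, 0 < del & forall Y : T -> R, measurable_fun setT Y ->
    (prokhorov P Y X < del%:E)%E -> U (ES P p (g \o Y)).
Proof.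
move=> m0 cA c0 g gfin gU; have [oA _] := cA; have mA := open_measurable oA.
have mgY (Y : T -> R) : measurable_fun setT Y -> measurable_fun setT (g \o Y).
  move=> mY; apply: measurableT_comp => //; exact: measurable_cap_off.
have [e e0 eU] := nbhs_ES p01 (mgY _ mX) gfin gU.
(* The stop-loss is affine in the probability of [A], with slope between 0 and [m] at every
   level. *)
have em : 0 < e / m by rewrite divr_gt0.
have [del del0 delP] := prokhorov_continuity_set cA em.
exists del => // Y mY /(delP _ mY); rewrite ler_norml => /andP[h1 h2].
suff key (Z W : T -> R) c' : measurable_fun setT Z -> measurable_fun setT W ->
    fine (P (Z @^-1` A)) - fine (P (W @^-1` A)) <= e / m ->
    (stop_loss P (g \o Z) c' <= stop_loss P (g \o W) c' + e%:E)%E.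
  by apply: eU => [|c'|c']; [exact: mgY|apply: key => //; lra|apply: key => //; lra].
move=> mZ mW ZW; rewrite !stop_loss_cap_off_cst// -EFinD lee_fin.
set al := Num.max (m - c') 0; set be := Num.max (Num.min m c - c') 0.
have ab : 0 <= al - be <= m.
  rewrite /al /be; have [?|?] := leP m c; have [?|?] := leP (m - c') 0; try lra;
  have [?|?] := leP (c - c') 0; lra.
rewrite -addrA lerD2l -lerBlDl -mulrBr.
apply: (@le_trans _ _ ((al - be) * (e / m))); first by rewrite ler_wpM2l//; case/andP: ab.
apply: (@le_trans _ _ (m * (e / m))); last by rewrite mulrC mulfVK// gt_eqF.
by rewrite ler_wpM2r ?(ltW em)//; case/andP: ab.
Qed.

End continuity_of_ES.

(** * Reduction to these two modes of convergence, and conclusion *)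

Lemma L1_le_Zdist (d : measure_display) (T : measurableType d) (R : realType)
  (P : probability T R) (s : zspace R) (Y X : T -> R) : s <> @ZL0 R -> zvalid s ->
  measurable_fun setT Y -> measurable_fun setT X ->
  (\int[P]_w `|Y w - X w|%:E <= Zdist P s Y X)%E.
Proof.
case: s => [|q|] // _ vq mY mX; have mYX := measurable_funB mY mX.
  exact: (L1_le_Lnormy P mYX).
exact: (L1_le_Lnorm P mYX vq).
Qed.

Lemma Zset_measurable (d : measure_display) (T : measurableType d) (R : realType)
  (P : probability T R) (s : zspace R) (Y : T -> R) :
  Zset P s Y -> measurable_fun setT Y.
Proof. by case: s => [[]|q []|]. Qed.

Lemma Zset_integrable (d : measure_display) (T : measurableType d) (R : realType)
  (P : probability T R) (s : zspace R) (X : T -> R) : s <> @ZL0 R -> zvalid s ->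
  Zset P s X -> (\int[P]_w `|X w|%:E < +oo)%E.
Proof.
case: s => [|q|] // _ vq [mX Xoo]; apply: le_lt_trans Xoo.
  exact: L1_le_Lnormy.
exact: L1_le_Lnorm.
Qed.

Lemma robust_cap_off (d : measure_display) (T : measurableType d) (R : realType)
  (P : probability T R) (X : T -> R) (gamma b : R -> R) (x0 p : R) (s : zspace R) :
  0 < p < 1 -> measurable_fun setT X -> continuous gamma -> (forall x, 0 < gamma x) ->
  (\int[P]_w (gamma (X w))%:E = 1)%E -> measurable_fun setT b ->
  (forall x, 0 <= b x) -> (\int[P]_w (gamma (X w) * b (X w))%:E < +oo)%E ->
  0 <= x0 -> (x0%:E < \int[P]_w (gamma (X w) * b (X w))%:E)%E ->
  (exists c, forall x, gamma x = c) \/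
    (forall c, P [set w | gamma (X w) = c] = 0%E) ->
  (forall A c U, continuity_set P X A -> 0 <= c -> let g := cap_off b A c in
    ES P p (g \o X) \is a fin_num -> nbhs (ES P p (g \o X)) U ->
    exists2 del : R, 0 < del & forall Y : T -> R, Zset P s Y ->
      (Zdist P s Y X < del%:E)%E -> U (ES P p (g \o Y))) ->
  robust_at (ES P p) (G_le P X gamma b x0) (Zset P s) (Zdist P s) X.
Proof.
move=> p01 mX cg g0 Eg mb b0 gboo x00 x0b gP cont.
have [A [c /= [cA c0 GA fin opt]]] :=
  exists_optimal_cap_off p01 mX cg g0 Eg mb b0 gboo x00 x0b gP.
by exists (cap_off b A c); split => // U; exact: cont.
Qed.

Theorem theorem2 (d : measure_display) (T : measurableType d) (R : realType)
  (P : probability T R) (X : T -> R) (gamma : R -> R) (x0 m p : R) :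
  atomless P -> standing P X gamma -> 0 < m -> 0 < p < 1 ->
  [/\
   (* (i) *)
   ((ess_sup P (fun w => (gamma (X w))%:E) <= ((1 - p)^-1)%:E)%E ->
      forall s : zspace R, zvalid s -> Zset P s X ->
        robust_at (ES P p) (G_cm P X gamma x0) (Zset P s) (Zdist P s) X),
   (* (ii) *)
   (0 <= x0 -> (x0%:E < Ex P (fun w => (gamma (X w) * X w)%R))%E ->
      ((exists c : R, forall x, gamma x = c) \/
       (continuous gamma /\ forall c : R, P [set w | gamma (X w) = c] = 0%E)) ->
      forall s : zspace R, s <> @ZL0 R -> zvalid s -> Zset P s X ->
        robust_at (ES P p) (G_ns P X gamma x0) (Zset P s) (Zdist P s) X) &
   (* (iii) *)
   (0 <= x0 < m ->
      ((exists c : R, forall x, gamma x = c) \/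
       (continuous gamma /\ forall c : R, P [set w | gamma (X w) = c] = 0%E)) ->
      forall s : zspace R, zvalid s -> Zset P s X ->
        robust_at (ES P p) (G_bd P X gamma x0 m) (Zset P s) (Zdist P s) X)].
Proof.
move=> _ st m0 p01; have [mX X0 _ [cg g0] [Eg EgX]] := st.
split=> [ess s _ _|x00 x0X gP s s0 vs ZX|/andP[x00 x0m] gP s vs ZX].
- exact: robust_cm.
(* The bound must be nonnegative on the whole line because a perturbation [Y] may be negative. As X
   >= 0, it agrees with the identity along [X], and the admissible set is unchanged. *)
- pose b x : R := Num.max x 0.
  have bX w : b (X w) = X w by rewrite /b max_l.
  have b0 x : 0 <= b x by rewrite le_max lexx orbT.
  have mb : measurable_fun setT b by exact: measurable_maxr.
  have blip u v : `|b u - b v| <= `|u - v|.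
    rewrite /b; have [?|?] := leP u 0; have [?|?] := leP v 0;
    rewrite ler_norml; have := ler_norm (u - v); have := ler_norm (v - u);
    rewrite (distrC v); lra.
  have bXE : (fun w => (gamma (X w) * b (X w))%:E) = (fun w => (gamma (X w) * X w)%:E).
    by apply/funext => w; rewrite bX.
  have -> : G_ns P X gamma x0 = G_le P X gamma b x0.
    by apply/seteqP; split => g [mg Eg' hg]; split => // w; have := hg w; rewrite bX.
  apply: robust_cap_off => //; rewrite ?bXE//.
    by case: gP => [|[]]; [left|right].
  move=> A c U cA c0 g fin gU.
  have boo : (\int[P]_w (b (X w))%:E < +oo)%E.
    apply: le_lt_trans (Zset_integrable s0 vs ZX).
    rewrite le_eqVlt; apply/orP; left; apply/eqP; apply: eq_integral => w _.
    by rewrite bX ger0_norm.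
  have [del del0 delP] := ES_cap_off_continuous_L1 p01 mX mb blip b0 boo cA c0 fin gU.
  exists del => // Y ZY YX; have mY := Zset_measurable ZY.
  by apply: delP => //; apply: le_lt_trans YX; exact: L1_le_Zdist.
(* Since E gamma = 1, the full exposure [m] has budget [m], so [x0 < m] is the strict feasibility
   condition. *)
- have gm : (\int[P]_w (gamma (X w) * m)%:E = m%:E)%E.
    under eq_integral do rewrite mulrC EFinM.
    rewrite ge0_integralZl_EFin ?(ltW m0)//.
    + by move: Eg; rewrite /Ex => ->; rewrite mule1.
    + by move=> w _; rewrite lee_fin ltW.
    + apply/measurable_EFinP; apply: measurableT_comp => //.
      exact: continuous_measurable_fun.
  apply: (@robust_cap_off _ _ _ _ _ _ (cst m)) => //; rewrite ?gm ?ltry ?lte_fin//.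
  + by move=> x; exact: ltW.
  + by case: gP => [|[]]; [left|right].
  move=> A c U cA c0 g fin gU.
  (* The Prokhorov distance does not control the L^1 distance, so [ZL0] uses the two-valued form of
     the exposure; the normed spaces go through L^1. *)
  have [->|s0] := pselect (s = @ZL0 R).
    have [del del0 delP] := ES_cap_off_continuous_prokhorov p01 mX m0 cA c0 fin gU.
    by exists del.
  have boo : (\int[P]_w (cst m (X w))%:E < +oo)%E.
    by rewrite (integral_cst P measurableT m%:E) [X in (_ * X)%E]probability_setT mule1 ltry.
  have blip (u v : R) : `|(cst m u : R) - cst m v| <= `|u - v| by rewrite subrr normr0.
  have [del del0 delP] := ES_cap_off_continuous_L1 p01 mX (measurable_cst m) blip
    (fun=> ltW m0) boo cA c0 fin gU.
  exists del => // Y ZY YX; have mY := Zset_measurable ZY.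
  by apply: delP => //; apply: le_lt_trans YX; exact: L1_le_Zdist.
Qed.
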